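(* Let $Q$ be in the Frobenius normal form described in the context, let $(X_i)$ be the associated absorbed Markov chain with initial distribution $\pi$ and absorption time $T$, and assume: (A1) for all $i\in\{1,\dots,k\}$ with $\rho_i<\rho_{\max}$, the diagonal block $Q_{ii}$ is scalar; (A2) there is $\theta\in\mathcal{P}_{\max}$ with $\alpha_\theta\neq0$ and $\pi_{\theta_1}v_{\theta_1}\neq0$. Let $\ell\in\{1,\dots,k\}$. Then: (i) if $\rho_\ell<\rho_{\max}$ or $\mathcal{P}^{(\ell)}_{\max}=\emptyset$, then $\lim_{n\to\infty}\mathbb{E}_\pi\big[\tfrac{1}{n+1}\#\{m\in\{0,\dots,n\}:X_m\in I_\ell\}\,\big|\,T>n\big]=0$; (ii) if $\rho_\ell=\rho_{\max}$ and $\mathcal{P}^{(\ell)}_{\max}\neq\emptyset$, then \[ \lim_{n\to\infty}\mathbb{E}_\pi\Big[\tfrac{1}{n+1}\#\{m\in\{0,\dots,n\}:X_m\in I_\ell\}\,\Big|\,T>n\Big]=\frac{\sum_{\theta\in\mathcal{P}^{(\ell)}_{\max}}\alpha_\theta\pi_{\theta_1}v_{\theta_1}\prod_{u\in H^-(\theta)}\frac{1}{\rho_{\max}-\rho_{\theta_u}}}{h^+_{\max}\sum_{\theta\in\mathcal{P}_{\max}}\alpha_\theta\pi_{\theta_1}v_{\theta_1}\prod_{u\in H^-(\theta)}\frac{1}{\rho_{\max}-\rho_{\theta_u}}}. \]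
   Context: Let $d\ge2$, $P=\begin{pmatrix}1&0\\R&Q\end{pmatrix}$ a stochastic $(d+1)\times(d+1)$ matrix with $R\in\mathbb{R}^{d\times1}$, $Q\in\mathbb{R}^{d\times d}$, $R,Q\ne0$, all eigenvalues of $Q$ of modulus $<1$. $(X_i)_{i\in\mathbb{N}_0}$ is the Markov chain with transition matrix $P$ (state $0$ absorbing), initial distribution $\pi$ on $\{1,\dots,d\}$, $T=\min\{i:X_i=0\}$. $Q$ is in Frobenius normal form: block lower triangular with blocks $Q_{ij}\in\mathbb{R}^{d_i\times d_j}$, $i,j\in\{1,\dots,k\}$, $Q_{ij}=0$ for $j>i$, each $Q_{ii}$ eventually positive with Perron--Frobenius eigenvalue $\rho_i$; $I_j=\{1+\sum_{i<j}d_i,\dots,\sum_{i\le j}d_i\}$; $\pi=(\pi_1,\dots,\pi_k)$ with $\pi_i\in\mathbb{R}^{1\times d_i}$. $v_i$ is a fixed normed positive right eigenvector of $Q_{ii}$ for $\rho_i$ ($v_i=1$ if $d_i=1$), $V_i^-$ the sum of the generalised eigenspaces of $Q_{ii}$ for its other eigenvalues. Admissible path: strictly decreasing $\theta=(\theta_1,\dots,\theta_\kappa)$ in $\{1,\dots,k\}$ with $Q_{\theta_u\theta_{u+1}}\ne0$ for $u<\kappa$; $\mathcal{P}$ the set of them, $\mathcal{P}^{(\ell)}$ those containing $\ell$. $\rho(\theta)=\max_u\rho_{\theta_u}$, $H^+(\theta)=\{u:\rho_{\theta_u}=\rho(\theta)\}$, $H^-(\theta)=\{u:\rho_{\theta_u}<\rho(\theta)\}$,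 $h^+(\theta)=\#H^+(\theta)$. $\rho_{\max}=\max_i\rho_i$, $h^+_{\max}=\max\{h^+(\theta):\theta\in\mathcal{P},\rho(\theta)=\rho_{\max}\}$, $\mathcal{P}_{\max}=\{\theta\in\mathcal{P}:h^+(\theta)=h^+_{\max},\ \rho(\theta)=\rho_{\max}\}$, $\mathcal{P}^{(\ell)}_{\max}=\mathcal{P}^{(\ell)}\cap\mathcal{P}_{\max}$. $\alpha_\theta=\alpha_{\theta_\kappa}\cdots\alpha_{\theta_1}$, where $\mathbf1=\alpha_{\theta_\kappa}v_{\theta_\kappa}+w_{\theta_\kappa}$ with $w_{\theta_\kappa}\in V^-_{\theta_\kappa}$ ($\mathbf 1$ the all-ones vector) and, for $u=\kappa-1,\dots,1$, $Q_{\theta_u\theta_{u+1}}v_{\theta_{u+1}}=\alpha_{\theta_u}v_{\theta_u}+w_{\theta_u}$ with $w_{\theta_u}\in V^-_{\theta_u}$. *)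

(* Defs.v *)
From HB Require Import structures.
From mathcomp Require Import all_boot all_order all_algebra.
From mathcomp Require Import boolp classical_sets reals topology normedtype sequences.
From mathcomp Require Import complex.
Set Implicit Arguments. Unset Strict Implicit. Unset Printing Implicit Defensive.
Import Order.TTheory GRing.Theory Num.Theory.
Local Open Scope ring_scope.

Section Defs.
Variable R : realType.

Definition toC (x : R) : R[i] := (x%:C)%C.

Definition cplx_eigenvalue n (A : 'M[R]_n) (z : R[i]) : Prop :=
  eigenvalue (map_mx toC A) z.

Definition stochastic n (P : 'M[R]_n) : Prop :=
  (forall i j, 0 <= P i j) /\ (forall i, \sum_j P i j = 1).

Definition eventually_positive n (A : 'M[R]_n) : Prop :=
  exists N : nat, forall m : nat, (N <= m)%N -> forall i j, 0 < (A ^+ m) i j.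

(* w lies in the sum of the generalised eigenspaces ker (A - lambda)^n of A
   (computed over the complex numbers) for the eigenvalues lambda <> r *)
Definition inVminus n (A : 'M[R]_n) (r : R) (w : 'cV[R]_n) : Prop :=
  exists s : seq (R[i] * 'cV[R[i]]_n),
    all (fun p => p.1 != toC r) s /\
    all (fun p => ((map_mx toC A - p.1%:M) ^+ n) *m p.2 == 0) s /\
    map_mx toC w = \sum_(p <- s) p.2.

Definition coef n (A : 'M[R]_n) (r : R) (v x : 'cV[R]_n) : R :=
  xget 0 (fun a => exists w, inVminus A r w /\ x = a *: v + w).

Variables (d k : nat) (dk : 'I_k -> nat).

(* I_j (0-based indices of the transient states 1..d, i.e. state x+1) *)
Definition block (j : 'I_k) : {set 'I_d} :=
  [set x : 'I_d | (\sum_(i < k | (i < j)%N) dk i <= x)%N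
                  && (x < \sum_(i < k | (i <= j)%N) dk i)%N].

Definition blk (Q : 'M[R]_d) (i j : 'I_k) : 'M[R]_(#|block i|, #|block j|) :=
  \matrix_(a, b) Q (enum_val a) (enum_val b).

Definition blkrow (pi : 'rV[R]_d) (i : 'I_k) : 'rV[R]_#|block i| :=
  \row_a pi 0 (enum_val a).

Variables (Q : 'M[R]_d) (rho : 'I_k -> R) (v : forall i : 'I_k, 'cV[R]_#|block i|).

Definition alpha_end (i : 'I_k) : R :=
  coef (blk Q i i) (rho i) (v i) (const_mx 1).
Definition alpha_step (i j : 'I_k) : R :=
  coef (blk Q i i) (rho i) (v i) (blk Q i j *m v j).

Fixpoint alpha_path (th : seq 'I_k) : R :=
  match th with
  | [::] => 1
  | [:: i] => alpha_end i
  | i :: ((j :: _) as t) => alpha_step i j * alpha_path t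
  end.

Definition admissible (th : seq 'I_k) : bool :=
  (th != [::]) && sorted (fun a b : 'I_k => (b < a)%N && (blk Q a b != 0)) th.

(* every strictly decreasing sequence is the decreasing enumeration of its
   (unique) underlying set; this lists the set P of admissible paths *)
Definition pathOf (A : {set 'I_k}) : seq 'I_k := rev (enum A).
Definition allPaths : seq (seq 'I_k) :=
  [seq th <- [seq pathOf A | A <- enum [set: {set 'I_k}]] | admissible th].

Definition rho_path (th : seq 'I_k) : R := \big[Num.max/0]_(i <- th) rho i.
Definition rho_max : R := \big[Num.max/0]_(i < k) rho i.
Definition hplus (th : seq 'I_k) : nat := count (fun i => rho i == rho_path th) th.
Definition hplus_max : nat :=
  \max_(th <- allPaths | rho_path th == rho_max) hplus th.
Definition inPmax (th : seq 'I_k) : bool :=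
  (hplus th == hplus_max) && (rho_path th == rho_max).

Variable pi : 'rV[R]_d.
Definition piv (i : 'I_k) : R := (blkrow pi i *m v i) 0 0.

Definition first_piv (th : seq 'I_k) : R :=
  if th is i :: _ then piv i else 0.

Definition weight (th : seq 'I_k) : R :=
  alpha_path th * first_piv th *
  \prod_(j <- th | rho j < rho_path th) (rho_max - rho j)^-1.

End Defs.

Section Chain.
Variable R : realType.
Variables (d : nat) (P : 'M[R]_(1 + d)) (pi : 'rV[R]_d).

Definition init_law (x : 'I_(1 + d)) : R :=
  if unlift ord0 x is Some y then pi 0 y else 0.

Definition path_prob n (x : {ffun 'I_n.+1 -> 'I_(1 + d)}) : R :=
  init_law (x ord0) *
  \prod_(m < n) P (x (widen_ord (leqnSn n) m)) (x (lift ord0 m)).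

Definition survives n (x : {ffun 'I_n.+1 -> 'I_(1 + d)}) : bool :=
  [forall m, x m != ord0].

Definition cond_exp n (f : {ffun 'I_n.+1 -> 'I_(1 + d)} -> R) : R :=
  (\sum_(x : {ffun 'I_n.+1 -> 'I_(1 + d)}) path_prob x * (survives x)%:R * f x) /
  (\sum_(x : {ffun 'I_n.+1 -> 'I_(1 + d)}) path_prob x * (survives x)%:R).

(* (1/(n+1)) #{m in 0..n : X_m in I_l}; transient state y+1 = lift ord0 y *)
Definition occ_frac (I : {set 'I_d}) n (x : {ffun 'I_n.+1 -> 'I_(1 + d)}) : R :=
  (#|[set m : 'I_n.+1 | [exists y in I, x m == lift ord0 y]]|)%:R / (n.+1)%:R.

End Chain.

Arguments block d {k} dk j.
Arguments alpha_path {R d k} dk Q rho v th.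
Arguments weight {R d k} dk Q rho v pi th.
Arguments first_piv {R d k} dk v pi th.
Arguments occ_frac {R d} I {n} x.
Arguments cond_exp {R d} P pi n f.

(* Main.v *)
Require Import Defs.
From HB Require Import structures.
From mathcomp Require Import all_boot all_order all_algebra.
From mathcomp Require Import boolp classical_sets reals topology normedtype sequences.
From mathcomp Require Import complex.
From mathcomp Require Import ring lra.
Import Order.TTheory GRing.Theory Num.Theory.
Local Open Scope ring_scope.
Import numFieldNormedType.Exports.
Local Open Scope classical_set_scope.
Set Implicit Arguments. Unset Strict Implicit. Unset Printing Implicit Defensive.

(* With N_n = sum_(m <= n) pi Q^m 1_(I_l) Q^(n-m) 1 and D_n = pi Q^n 1, the
   conditional expectation is N_n / ((n + 1) D_n).  Splitting 1 = sum_i (projection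
   on block i) between consecutive factors writes D_n as a sum over admissible paths
   of iterated convolutions of the powers of the diagonal blocks; N_n is the same sum
   in which block l occurs twice.  By Perron-Frobenius, Q_ii^n / rho_i^n tends to the
   rank one projection v_i u_i, and u_i is the functional x |-> coefficient of v_i in
   the decomposition x = a v_i + w with w in V_i^-.  After division by rho_max^n, a
   block with rho_i = rho_max therefore raises the order of polynomial growth by one,
   and a scalar block with rho_i < rho_max acts as a summable geometric filter of mass
   rho_max / (rho_max - rho_i).  Hence D_n ~ rho_max^n C(n+h-1, h-1) times the sum of
   the weights of the maximal paths, N_n ~ rho_max^n C(n+h, h) times the sum over
   those through l, and the quotient of the two binomials is (n + h) / h. *)

(** * Orders of growth *)

Section Sequences.
Variable R : realType.
Implicit Types (a b u x z : nat -> R) (p q n m k : nat).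

(* An inductive wrapper rather than an abbreviation: the convergence predicate
   unfolds to an implication, which disturbs unification and implicit arguments. *)
Inductive tends u (l : R) : Prop := Tends of u @ \oo --> l.

Lemma tendsE u l : tends u l = (u @ \oo --> l).
Proof. by apply/propext; split=> [[]|]. Qed.

Lemma tendsP u l :
  tends u l <->
  forall e, 0 < e -> exists N, forall n, (N <= n)%N -> `|u n - l| <= e.
Proof.
rewrite tendsE; split=> [/cvgrPdist_le ul e e0 | ul].
  have [N _ HN] := ul e e0; exists N => n Nn; rewrite distrC; exact: HN.
apply/cvgrPdist_le => e e0; have [N HN] := ul e e0.
by exists N => // n /= Nn; rewrite distrC; exact: HN.
Qed.

Lemma tends_eq u z l : u =1 z -> tends u l -> tends z l.
Proof. by move=> /funext ->. Qed.

Lemma tends_cst (l : R) : tends (fun=> l) l.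
Proof. by split; exact: cvg_cst. Qed.

Lemma tendsD u z l l' : tends u l -> tends z l' -> tends (fun n => u n + z n) (l + l').
Proof. by move=> [ul] [zl]; split; exact: cvgD. Qed.

Lemma tendsB u z l l' : tends u l -> tends z l' -> tends (fun n => u n - z n) (l - l').
Proof. by move=> [ul] [zl]; split; exact: cvgB. Qed.

Lemma tendsM u z l l' : tends u l -> tends z l' -> tends (fun n => u n * z n) (l * l').
Proof. by move=> [ul] [zl]; split; exact: cvgM. Qed.

Lemma tendsV u l : l != 0 -> tends u l -> tends (fun n => (u n)^-1) l^-1.
Proof. by move=> l0 [ul]; split; exact: cvgV. Qed.

Lemma tends_norm u l : tends u l -> tends (fun n => `|u n|) `|l|.
Proof. by move=> [ul]; split; exact: cvg_norm. Qed.

Lemma tends_succ u l : tends u l -> tends (fun n => u n.+1) l.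
Proof. by move=> [ul]; split; rewrite (cvg_shiftS u). Qed.

Lemma tends_of_succ u l : tends (fun n => u n.+1) l -> tends u l.
Proof. by move=> [ul]; split; rewrite -(cvg_shiftS u). Qed.

Lemma tends_of_shift m u l : tends (fun n => u (n + m)%N) l -> tends u l.
Proof. by move=> [ul]; split; rewrite -(cvg_shiftn m u). Qed.

Lemma tends_unique u l l' : tends u l -> tends u l' -> l = l'.
Proof. by move=> [ul] [ul']; exact: (cvg_unique _ ul ul'). Qed.

Lemma tends_sum (I : Type) (r : seq I) (P : pred I) (F : I -> nat -> R) (l : I -> R) :
  (forall i, P i -> tends (F i) (l i)) ->
  tends (fun n => \sum_(i <- r | P i) F i n) (\sum_(i <- r | P i) l i).
Proof.
move=> Fl; elim: r => [|i r IHr].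
  rewrite big_nil; apply: (tends_eq _ (tends_cst 0)) => n; by rewrite big_nil.
rewrite big_cons; case: ifP => Pi; last first.
  by apply: (tends_eq _ IHr) => n; rewrite big_cons Pi.
by apply: (tends_eq _ (tendsD (Fl i Pi) IHr)) => n; rewrite big_cons Pi.
Qed.

Lemma tends_ub u l : tends u l -> exists2 W, 0 <= W & forall n, u n <= W.
Proof.
move=> [ul]; have /cvg_has_ub [W Wub] : cvgn u by apply/cvg_ex; exists l.
exists W => [|n]; last by apply: le_trans (ler_norm _) _; apply: Wub; exists n.
by apply: le_trans (normr_ge0 (u 0%N)) _; apply: Wub; exists 0%N.
Qed.

Lemma tends_ge0 u l : (forall n, 0 <= u n) -> tends u l -> 0 <= l.
Proof.
move=> u0 [ul]; rewrite -(cvg_lim (@Rhausdorff R) ul).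
by apply: limr_ge; [apply/cvg_ex; exists l | near=> n].
Unshelve. all: by end_near.
Qed.

Lemma squeeze0 u z : (forall n, `|u n| <= z n) -> tends z 0 -> tends u 0.
Proof.
move=> uz /tendsP z0; apply/tendsP => e /z0 [N HN]; exists N => n /HN.
rewrite !subr0; apply: le_trans; exact: le_trans (uz n) (ler_norm _).
Qed.

(** Toeplitz's lemma for null sequences. Cut the sum where [x] becomes small: the tail is controlled
    by the bounded row sums, and the head is a finite sum of terms that vanish because each column
    of weights does. *)
Lemma toeplitz0 (w : nat -> nat -> R) (W : R) x :
  (forall n m, 0 <= w n m) -> (forall n, \sum_(m < n.+1) w n m <= W) ->
  (forall m, tends (fun n => w n m) 0) -> tends x 0 ->
  tends (fun n => \sum_(m < n.+1) w n m * x m) 0.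
Proof.
move=> w0 wW wl /tendsP x0; apply/tendsP => e e0.
have W0 : 0 <= W by apply: le_trans (wW 0%N); apply: sumr_ge0.
(* The denominator is [W + 1] because the bound [W] on the row sums may be zero. *)
have [N HN] := x0 (e / 2 / (W + 1)) ltac:(by rewrite !divr_gt0 // ltr_wpDl).
have : tends (fun n => \sum_(m < N) w n m * x m) 0.
  have := @tends_sum _ (index_enum 'I_N) xpredT (fun (m : 'I_N) n => w n m * x m) (fun=> 0).
  rewrite big1 //; apply => m _.
  have := tendsM (wl m) (tends_cst (x m)); rewrite mul0r; exact.
move=> /tendsP /(_ (e / 2) ltac:(by rewrite divr_gt0)) [N' HN'].
exists (maxn N N') => n; rewrite geq_max => /andP[Nn /HN']; rewrite !subr0 => t_le.
rewrite -(big_mkord xpredT (fun m => w n m * x m)) (big_cat_nat (leq0n N) (leqW Nn)) /=.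
apply: le_trans (ler_normD _ _) _; rewrite (splitr e).
apply: lerD; first by rewrite big_mkord.
apply: le_trans (ler_norm_sum _ _ _) _.
have : \sum_(N <= m < n.+1) w n m * (e / 2 / (W + 1)) <= e / 2.
  rewrite -mulr_suml; apply: (@le_trans _ _ (W * (e / 2 / (W + 1)))).
    apply: ler_wpM2r; first by rewrite !divr_ge0 ?addr_ge0 // ltW.
    apply: le_trans (wW n); rewrite -(big_mkord xpredT (w n)).
    by rewrite (big_cat_nat (leq0n N) (leqW Nn)) /= lerDr sumr_ge0.
  have W1 : 0 < W + 1 by rewrite ltr_wpDl.
  by rewrite mulrA ler_pdivrMr // mulrC ler_wpM2l ?lerDl // divr_ge0 // ltW.
apply: le_trans; rewrite big_seq [leRHS]big_seq; apply: ler_sum => m.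
rewrite mem_index_iota => /andP[Nm _]; rewrite normrM ger0_norm // ler_wpM2l //.
by have := HN m Nm; rewrite subr0.
Qed.

(** The coefficient of x^n in (1 - x)^-(p+1), of size n^p / p!. As a gauge it is handier than n^p,
    since partial sums carry [binr p] exactly to [binr p.+1]. *)
Definition binr p n : R := ('C(n + p, p))%:R.

Lemma binr_gt0 p n : 0 < binr p n.
Proof. by rewrite ltr0n bin_gt0 leq_addl. Qed.

Lemma binr_ge0 p n : 0 <= binr p n.
Proof. exact/ltW/binr_gt0. Qed.

Lemma binr_neq0 p n : binr p n != 0.
Proof. by rewrite gt_eqF ?binr_gt0. Qed.

Lemma binr0 n : binr 0 n = 1.
Proof. by rewrite /binr bin0. Qed.

Lemma binrS p n : binr p.+1 n * p.+1%:R = binr p n * (n + p.+1)%:R.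
Proof. by rewrite -!natrM mulnC addnS -mul_bin_diag mulnC. Qed.

Lemma binr_succ p n : binr p n.+1 * n.+1%:R = binr p n * (n + p.+1)%:R.
Proof.
rewrite -!natrM; congr (_%:R); rewrite mulnC addSnnS addnS mulnC.
by have /= := mul_bin_down (n + p).+1 p; rewrite mulnC => ->; rewrite subSn ?leq_addl // addnK mulnC.
Qed.

Lemma sum_binr p n : \sum_(m < n.+1) binr p m = binr p.+1 n.
Proof.
elim: n => [|n IHn]; first by rewrite big_ord1 /binr !add0n !binn.
by rewrite big_ord_recr /= IHn /binr -natrD addSn addnS binS -addSnnS.
Qed.

Lemma cvg_nat_ratio (c : nat) : tends (fun n => c%:R / (n + c)%:R : R) 0.
Proof.
apply: (@squeeze0 _ (fun n => c%:R * harmonic n)) => [n|]; last first.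
  by have := tendsM (tends_cst (c%:R : R)) (Tends (@cvg_harmonic R)); rewrite mulr0; exact.
rewrite ger0_norm ?divr_ge0 //; case: c => [|c]; first by rewrite !mul0r.
by rewrite ler_wpM2l // lef_pV2 ?posrE ?ltr0n ?addnS // ler_nat ltnS leq_addr.
Qed.

Lemma binr_ratio0 p : tends (fun n => binr p n / binr p.+1 n) 0.
Proof.
apply: (tends_eq _ (cvg_nat_ratio p.+1)) => n.
have := binrS p n; have := binr_neq0 p.+1 n.
have : (n + p.+1)%:R != 0 :> R by rewrite pnatr_eq0 addnS.
by move=> ? ? H; apply/eqP; rewrite eqr_div // mulrC H.
Qed.

Lemma binr_ratio1 p : tends (fun n => binr p n / binr p n.+1) (1 : R).
Proof.
have H : tends (fun n => 1 - p%:R / (n.+1 + p)%:R : R) (1 : R).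
  have := tendsB (tends_cst (1 : R)) (tends_succ (cvg_nat_ratio p)).
  by rewrite subr0; exact.
apply: (tends_eq _ H) => n; clear H.
have := binr_succ p n; have := binr_neq0 p n.+1; rewrite addnS -addSn.
have : (n.+1 + p)%:R != 0 :> R by rewrite pnatr_eq0 addSn.
move=> n0 ? H; rewrite -[X in X - _](divff n0) -mulrBl -natrB ?leq_addl // addnK.
by apply/eqP; rewrite eqr_div // mulrC H.
Qed.

Lemma binr_homo p n m : (n <= m)%N -> binr p n <= binr p m.
Proof. by move=> nm; rewrite ler_nat; apply: leq_bin2l; rewrite leq_add2r. Qed.

Lemma binr_homol p q n : (p <= q)%N -> binr p n <= binr q n.
Proof.
elim: q => [|q IHq]; first by rewrite leqn0 => /eqP ->.
rewrite leq_eqVlt => /predU1P[->//|/IHq h]; apply: le_trans h _.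
rewrite -(ler_pM2r (ltr0Sn R q)) binrS ler_wpM2l ?ler_nat ?leq_addl //.
Qed.

(* [asym p a L] says that the power series of [a] behaves like [L / (1 - x)^p] near [1]. *)
Definition asym p a (L : R) : Prop :=
  (forall n, 0 <= a n) /\
  match p with
  | 0 => tends (fun n => \sum_(m < n.+1) a m) L
  | p.+1 => tends (fun n => a n / binr p n) L
  end.

Lemma asym_ge0 p a L n : asym p a L -> 0 <= a n. Proof. by case. Qed.

Lemma asym_eq p a b L : a =1 b -> asym p a L -> asym p b L.
Proof. by move=> /funext ->. Qed.

(** Paths of non-maximal order are discarded by this. At order [0] the terms of a convergent series
    tend to zero and every gauge is at least [1]; at order [p.+1] the quotient
    [binr p n / binr p.+1 n] vanishes. *)
Lemma asym_lt p q a L : asym p a L -> (p <= q)%N ->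
  tends (fun n => a n / binr q n) 0.
Proof.
case: p => [|p] [a0 aL] pq.
  have : tends a 0.
    split; apply: cvg_series_cvg_0; apply/cvg_ex; exists L; rewrite -tendsE; apply: tends_of_succ.
    by apply: (tends_eq _ aL) => n; rewrite seriesEord.
  move=> H; apply: (squeeze0 _ H) => n; rewrite ger0_norm ?divr_ge0 ?binr_ge0 //.
  by rewrite ler_piMr // invf_le1 ?binr_gt0 // -(binr0 n) binr_homol.
have := tendsM aL (binr_ratio0 p); rewrite mulr0 => H; apply: (squeeze0 _ H) => n /=.
rewrite ger0_norm ?divr_ge0 ?binr_ge0 // mulrA divfK ?binr_neq0 //.
by rewrite ler_wpM2l // lef_pV2 ?posrE ?binr_gt0 ?binr_homol.
Qed.

(** Stolz-Cesaro for the binomial gauge: the quotient is an average of the ratios [a m / binr p m]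
    with weights [binr p m / binr p.+1 n], which sum to [1]. Toeplitz's lemma disposes of the
    deviations from [L]. *)
Lemma stolz p a (L : R) : tends (fun n => a n / binr p n) L ->
  tends (fun n => (\sum_(m < n.+1) a m) / binr p.+1 n) L.
Proof.
move=> aL; pose x n := a n / binr p n - L.
have x0 : tends x 0.
  by have := tendsB aL (tends_cst L); rewrite subrr; exact.
pose w n m := binr p m / binr p.+1 n.
have w0 n m : 0 <= w n m by rewrite divr_ge0 ?binr_ge0.
have wE n : \sum_(m < n.+1) w n m = 1.
  by rewrite -mulr_suml sum_binr divff ?binr_neq0.
have wl m : tends (fun n => w n m) 0.
  have := tendsM (tends_cst (binr p m)) (binr_ratio0 p); rewrite mulr0 => H.
  apply: (squeeze0 _ H) => n; rewrite ger0_norm // ler_wpM2l ?binr_ge0 //.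
  by rewrite ler_peMl ?invr_ge0 ?binr_ge0 // -(binr0 n) binr_homol.
have := toeplitz0 (W := 1) w0 _ wl x0.
move=> /(_ (fun n => ltac:(by rewrite wE))) T.
have := tendsD T (tends_cst L); rewrite add0r => H; apply: (tends_eq _ H) => n /=.
transitivity (\sum_(m < n.+1) (w n m * x m + w n m * L)).
  by rewrite big_split /= -(mulr_suml _ _ _ L) wE mul1r.
rewrite mulr_suml; apply: eq_bigr => m _.
by rewrite -mulrDr /x subrK /w mulrC mulrA divfK ?binr_neq0.
Qed.

Lemma asym_series p a L : asym p a L ->
  tends (fun n => (\sum_(m < n.+1) a m) / binr p n) L.
Proof.
case: p => [|p] [a0 aL]; last exact: stolz.
by apply: (tends_eq _ aL) => n; rewrite binr0 divr1.
Qed.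

(** * Convolutions and their effect on the order of growth *)

Definition conv b a n : R := \sum_(m < n.+1) b (n - m)%N * a m.

Lemma conv_rev b a n : conv b a n = \sum_(m < n.+1) b m * a (n - m)%N.
Proof.
rewrite /conv (reindex_inj rev_ord_inj) /=; apply: eq_bigr => m _.
by rewrite subSS subKn // -ltnS.
Qed.

Lemma conv_ge0 b a : (forall n, 0 <= b n) -> (forall n, 0 <= a n) ->
  forall n, 0 <= conv b a n.
Proof. by move=> b0 a0 n; apply: sumr_ge0 => m _; rewrite mulr_ge0. Qed.

(** Write [b] as its limit plus a null sequence. The limit contributes [beta] times the partial sums
    of [a], whose order is one higher; the null part dies by Toeplitz's lemma with weights
    [a (n - m) / binr p n]. *)
Lemma asym_conv_cvg p a b L (beta : R) :
  (forall n, 0 <= b n) -> tends b beta -> asym p a L ->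
  asym p.+1 (conv b a) (beta * L).
Proof.
move=> b0 bl aL; have a0 n := asym_ge0 n aL; split; first exact: conv_ge0.
pose x n := b n - beta.
have x0 : tends x 0.
  by have := tendsB bl (tends_cst beta); rewrite subrr; exact.
pose w n m := a (n - m)%N / binr p n.
have w0 n m : 0 <= w n m by rewrite divr_ge0 ?binr_ge0.
have wE n : \sum_(m < n.+1) w n m = (\sum_(m < n.+1) a m) / binr p n.
  rewrite -mulr_suml; congr (_ / _); have := conv_rev (fun=> 1) a n.
  by rewrite /conv; under eq_bigr do rewrite mul1r;
     under [in RHS]eq_bigr do rewrite mul1r.
have [W W0 HW] := tends_ub (asym_series aL).
have wl m : tends (fun n => w n m) 0.
  apply: (@tends_of_shift m); apply: (squeeze0 _ (asym_lt aL (leqnn p))) => n.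
  rewrite ger0_norm // /w addnK ler_wpM2l // lef_pV2 ?posrE ?binr_gt0 //.
  by rewrite binr_homo ?leq_addr.
have T := toeplitz0 w0 (fun n => ltac:(by rewrite wE; exact: HW)) wl x0.
have := tendsD T (tendsM (tends_cst beta) (asym_series aL)); rewrite add0r => H; apply: (tends_eq _ H) => n /=.
rewrite -wE mulr_sumr -big_split conv_rev mulr_suml; apply: eq_bigr => m _ /=.
by rewrite /w /x; ring.
Qed.

(** Unrolling the recursion bounds [e] by a geometric term plus the convolution of [|x|] with powers
    of [q]. The row sums of these powers are at most 1 / (1 - q), so Toeplitz's lemma applies. *)
Lemma contraction0 (q : R) (e x : nat -> R) : 0 <= q < 1 ->
  (forall n, `|e n.+1| <= q * `|e n| + x n) -> tends x 0 ->
  tends e 0.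
Proof.
move=> /andP[q0 q1] ex x0.
have x0' : tends (fun n => `|x n|) 0.
  by have := tends_norm x0; rewrite normr0.
have qn : `|q| < 1 by rewrite ger0_norm.
apply: tends_of_succ.
pose w n m := q ^+ (n - m).
have T : tends (fun n => \sum_(m < n.+1) w n m * `|x m|) 0.
  apply: (toeplitz0 (W := (1 - q)^-1)) x0' => [n m|n|m]; first exact: exprn_ge0.
    have -> : \sum_(m < n.+1) w n m = \sum_(m < n.+1) q ^+ m.
      have := conv_rev (fun m => q ^+ m) (fun=> 1) n.
      by rewrite /conv; under eq_bigr do rewrite mulr1;
         under [in RHS]eq_bigr do rewrite mulr1.
    have q1' : 0 < 1 - q by rewrite subr_gt0.
    have -> : \sum_(m < n.+1) q ^+ m = (1 - q)^-1 * (1 - q ^+ n.+1).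
      by rewrite -[1 - q ^+ _]opprB subrX1 -mulNr opprB mulKf ?gt_eqF.
    by rewrite ler_piMr ?invr_ge0 ?(ltW q1') // gerBl exprn_ge0.
  by apply: (@tends_of_shift m); apply: (tends_eq _ (Tends (cvg_expr qn))) => n; rewrite /w addnK.
have := tendsD (tendsM (tends_cst `|e 0%N|) (Tends (cvg_expr qn))) T; rewrite mulr0 addr0 => H.
have {}H : tends (fun n => `|e 0%N| * q ^+ n + \sum_(m < n.+1) w n m * `|x m|) 0.
  exact: H.
(* The bound on [e n.+1] carries [q ^+ n]: one factor [q] is given away at the start of the
   induction. *)
apply: (squeeze0 _ H); elim=> [|n IHn].
  rewrite expr0 mulr1 big_ord1 /w expr0 mul1r; apply: le_trans (ex 0%N) _.
  by apply: lerD; [rewrite ler_piMl // ltW | exact: ler_norm].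
apply: le_trans (ex n.+1) _; rewrite big_ord_recr /= /w subnn mul1r addrA.
apply: lerD; last exact: ler_norm.
apply: le_trans (ler_wpM2l q0 IHn) _; rewrite mulrDr exprS mulrCA lerD2l.
rewrite mulr_sumr; apply: ler_sum => m _; rewrite mulrA -exprS -subSn //.
by rewrite -ltnS.
Qed.

(** The proposed limit [l] is the fixed point of l = q l + L. The deviation of [t n / binr p n] from
    it contracts by [q] at each step, up to errors coming from [z] and from
    [binr p n / binr p n.+1], which tends to [1]. *)
Lemma geometric_filter (q : R) p t z (L : R) : 0 <= q < 1 ->
  (forall n, t n.+1 = q * t n + z n.+1) ->
  tends (fun n => z n / binr p n) L ->
  tends (fun n => t n / binr p n) ((1 - q)^-1 * L).
Proof.
move=> q01 tz zL; set l := _ * L.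
have q1 : 1 - q != 0 by move: q01 => /andP[_ q1]; rewrite gt_eqF ?subr_gt0.
have lE : l = q * l + L by rewrite /l; field.
pose r n := binr p n / binr p n.+1.
pose e n := t n / binr p n - l.
pose x n := `|z n.+1 / binr p n.+1 - L| + `|q * l * (r n - 1)|.
have x0 : tends x 0.
  have zL' := tends_succ zL.
  have H1 := tends_norm (tendsB zL' (tends_cst L)).
  have H2 := tends_norm (tendsM (tends_cst (q * l)) (tendsB (binr_ratio1 p) (tends_cst (1 : R)))).
  by have := tendsD H1 H2; rewrite !subrr mulr0 !normr0 addr0; exact.
have e0 : tends e 0.
  apply: (contraction0 q01 (x := x)) => // n.
  have -> : e n.+1 = q * r n * e n + ((z n.+1 / binr p n.+1 - L) + q * l * (r n - 1)).
    rewrite /e /r tz [in LHS]lE; have := binr_neq0 p n; have := binr_neq0 p n.+1.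
    by move=> ? ?; field; apply/andP.
  apply: le_trans (ler_normD _ _) (lerD _ (ler_normD _ _)).
  have r0 : 0 <= r n by rewrite divr_ge0 ?binr_ge0.
  have q0 : 0 <= q by case/andP: q01.
  rewrite [leLHS]normrM (ger0_norm (mulr_ge0 q0 r0)) ler_wpM2r //.
  rewrite ler_piMr // ler_pdivrMr ?binr_gt0 // mul1r.
  exact: binr_homo.
have := tendsD e0 (tends_cst l); rewrite add0r => H; apply: (tends_eq _ H) => n /=.
by rewrite /e subrK.
Qed.

Lemma conv_geo_rec (q : R) a n :
  conv (fun k => q ^+ k) a n.+1 = q * conv (fun k => q ^+ k) a n + a n.+1.
Proof.
rewrite /conv big_ord_recr /= subnn mul1r mulr_sumr; congr (_ + _).
by apply: eq_bigr => m _; rewrite mulrA -exprS subSn // -ltnS.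
Qed.

(** For positive order the convolution satisfies the filter recursion directly. At order [0] its
    partial sums satisfy the same recursion, driven by the partial sums of [a], with constant gauge
    [binr 0]. *)
Lemma asym_conv_geo (q : R) p a L : 0 <= q < 1 -> asym p a L ->
  asym p (conv (fun k => q ^+ k) a) ((1 - q)^-1 * L).
Proof.
move=> q01 [a0 aL]; split.
  by apply: conv_ge0 => // n; apply: exprn_ge0; case/andP: q01.
case: p aL => [|p] aL; last first.
  by apply: geometric_filter aL => // n; exact: conv_geo_rec.
have : tends (fun n => (\sum_(m < n.+1) a m) / binr 0 n) L.
  by apply: (tends_eq _ aL) => n; rewrite binr0 divr1.
move/(geometric_filter (q := q)
       (t := fun n => \sum_(m < n.+1) conv (fun k => q ^+ k) a m) q01) => H.
have {}H := H _; apply: (tends_eq _ (H _)) => [n|]; first by rewrite binr0 divr1.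
elim=> [|n IHn].
  rewrite !big_ord_recr !big_ord0 /= conv_geo_rec.
  by have -> : conv (fun k => q ^+ k) a 0 = a 0%N; rewrite ?/conv ?big_ord1 ?mul1r //; ring.
rewrite [LHS]big_ord_recr /= conv_geo_rec {1}IHn.
rewrite [\sum_(m < n.+3) a m]big_ord_recr [\sum_(m < n.+2) conv _ a m]big_ord_recr /=.
by ring.
Qed.

Definition delay a n : R := if n is m.+1 then a m else 0.

(** A delay multiplies the power series by x, which does not change its leading behaviour at x =
    1. *)
Lemma asym_delay p a L : asym p a L -> asym p (delay a) L.
Proof.
case: p => [|p] [a0 aL]; (split; first by case); apply: tends_of_succ.
  by apply: (tends_eq _ aL) => n; rewrite [RHS]big_ord_recl add0r; apply: eq_bigr.
have := tendsM aL (binr_ratio1 p); rewrite mulr1 => H; apply: (tends_eq _ H) => n /=.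
by rewrite mulrA divfK ?binr_neq0.
Qed.

Lemma asym_sum p (I : Type) (r : seq I) (P : pred I) (c L : I -> R)
    (a : I -> nat -> R) :
  (forall i, P i -> 0 <= c i) -> (forall i, P i -> asym p (a i) (L i)) ->
  asym p (fun n => \sum_(i <- r | P i) c i * a i n) (\sum_(i <- r | P i) c i * L i).
Proof.
move=> c0 aL; split=> [n|]; first by apply: sumr_ge0 => i Pi; rewrite mulr_ge0 ?c0 ?(asym_ge0 n (aL i Pi)).
case: p aL => [|p] aL.
  have := @tends_sum _ r P (fun i n => c i * \sum_(m < n.+1) a i m) (fun i => c i * L i).
  move=> H; apply: (tends_eq _ (H _)) => [n|i Pi].
    by rewrite exchange_big /=; apply: eq_bigr => i Pi; rewrite mulr_sumr.
  by apply: tendsM; [exact: tends_cst | exact: (aL i Pi).2].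
have := @tends_sum _ r P (fun i n => c i * (a i n / binr p n)) (fun i => c i * L i).
move=> H; apply: (tends_eq _ (H _)) => [n|i Pi].
  by rewrite mulr_suml; apply: eq_bigr => i Pi; rewrite mulrA.
by apply: tendsM; [exact: tends_cst | exact: (aL i Pi).2].
Qed.

Lemma asym_impulse (c : R) : 0 <= c -> asym 0 (fun n => if n is 0 then c else 0) c.
Proof.
move=> c0; split=> [[|n]//|]; apply: (@tends_eq (fun=> c)) => [n|]; last exact: tends_cst.
by rewrite big_ord_recl big1 ?addr0.
Qed.

End Sequences.

(** * Perron-Frobenius *)

Lemma mulmx_eigen_pow (F : comNzRingType) n (B : 'M[F]_n) rho (v : 'cV[F]_n) m :
  B *m v = rho *: v -> (B ^+ m) *m v = rho ^+ m *: v.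
Proof.
move=> Bv; elim: m => [|m IHm]; first by rewrite !expr0 scale1r -[RHS]mul1mx.
by rewrite !exprS -mulmxE -mulmxA IHm -scalemxAr Bv scalerA mulrC.
Qed.

Lemma mulmx_left_eigen_pow (F : comNzRingType) n (B : 'M[F]_n) rho (u : 'rV[F]_n) m :
  u *m B = rho *: u -> u *m (B ^+ m) = rho ^+ m *: u.
Proof.
move=> Bu; elim: m => [|m IHm]; first by rewrite !expr0 scale1r -[RHS]mulmx1.
by rewrite exprS -mulmxE mulmxA Bu -scalemxAl IHm scalerA -exprS.
Qed.

Section Perron.
Variable R : realType.

Lemma stochastic_pow n (S : 'M[R]_n) m : stochastic S -> stochastic (S ^+ m).
Proof.
move=> [S0 S1]; elim: m => [|m [IH0 IH1]].
  split=> i; last by rewrite (bigD1 i) //= big1 ?mxE ?eqxx ?addr0 // => j /negPf;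
    rewrite mxE eq_sym => ->.
  by move=> j; rewrite mxE; case: (_ == _).
split=> [i j|i]; rewrite exprS -mulmxE.
  by rewrite mxE sumr_ge0 // => k _; rewrite mulr_ge0.
under eq_bigr do rewrite mxE.
rewrite exchange_big /= -[RHS](S1 i); apply: eq_bigr => k _.
by rewrite -mulr_sumr IH1 mulr1.
Qed.

(** Row [i] puts mass at least [de] on the state [i0], so an average of [f] is pulled from either
    bound towards [f i0] by at least the fraction [de]. *)
Lemma stochastic_contract n (T : 'M[R]_n) (f : 'I_n -> R) (lo hi de : R) i0 i :
  stochastic T -> de <= T i i0 -> (forall k, lo <= f k <= hi) ->
  lo + de * (f i0 - lo) <= \sum_k T i k * f k <= hi - de * (hi - f i0).
Proof.
move=> [T0 T1] dT f_itv.
have E c : \sum_k T i k * f k = c + \sum_k T i k * (f k - c).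
  under [in RHS]eq_bigr do rewrite mulrBr.
  by rewrite sumrB -mulr_suml T1 mul1r addrC subrK.
have f_lo k : 0 <= f k - lo by rewrite subr_ge0; case/andP: (f_itv k).
have f_hi k : f k - hi <= 0 by rewrite subr_le0; case/andP: (f_itv k).
apply/andP; split.
  rewrite (E lo) lerD2l (bigD1 i0) //=; apply: (@le_trans _ _ (T i i0 * (f i0 - lo))).
    exact: ler_wpM2r.
  by rewrite lerDl sumr_ge0 // => k _; rewrite mulr_ge0.
rewrite (E hi) lerD2l (bigD1 i0) //= -mulrN opprB.
apply: (@le_trans _ _ (T i i0 * (f i0 - hi))).
  by rewrite gerDl sumr_le0 // => k _; rewrite mulr_ge0_le0.
exact: ler_wnM2r.
Qed.

(** Doeblin's argument, column by column: every [N.+1] steps an interval enclosing all entries of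
    column [j] shrinks by a fixed factor, so the entries share a limit that does not depend on the
    row. *)
Lemma stochastic_power_limit n (S : 'M[R]_n) N : stochastic S ->
  (forall i j, 0 < (S ^+ N.+1) i j) ->
  exists mu : 'rV[R]_n, forall i j, tends (fun m => (S ^+ m) i j) (mu 0 j).
Proof.
move=> SS SN.
suff col j : exists l : R, forall i, tends (fun m => (S ^+ m) i j) l.
  have [mu Hmu] := choice col; exists (\row_j mu j) => i j; rewrite mxE; exact: Hmu.
pose f m i := (S ^+ m) i j.
have fD m m' i : f (m' + m)%N i = \sum_k (S ^+ m') i k * f m k.
  by rewrite /f exprD -mulmxE mxE.
pose de := \big[Num.min/1]_i f N.+1 i.
have de0 : 0 < de by apply: lt_bigmin => // i _; exact: SN.
have de1 : de <= 1 by exact: bigmin_le_id.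
have de_le i : de <= f N.+1 i by exact: bigmin_inf.
(* Both ends move by the fraction [de] towards the same value, the entry at row [j], so the width is
   multiplied by exactly [1 - de]. *)
pose step k (b : R * R) := (b.1 + de * (f (k * N.+1)%N j - b.1), b.2 - de * (b.2 - f (k * N.+1)%N j)).
pose bnd := fix bnd k : R * R := if k is k'.+1 then step k' (bnd k') else (0, 1).
pose lo k := (bnd k).1; pose hi k := (bnd k).2.
have width k : hi k - lo k = (1 - de) ^+ k.
  by elim: k => [|k IHk]; rewrite ?subr0 ?expr0 // exprS -IHk /hi /lo /=; ring.
have bndf k m i : (k * N.+1 <= m)%N -> lo k <= f m i <= hi k.
  elim: k m i => [|k IHk] m i.
    move=> _; have [P0 P1] := stochastic_pow m SS; rewrite [f m i]/((S ^+ m) i j) P0 /=.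
    by rewrite -[hi 0%N]/(1 : R) -(P1 i) (bigD1 j) //= lerDl sumr_ge0.
  have base i' : lo k.+1 <= f (k.+1 * N.+1)%N i' <= hi k.+1.
    rewrite mulSn fD; apply: stochastic_contract => [||k']; first exact: stochastic_pow.
      exact: de_le.
    exact: IHk.
  (* Between multiples of [N.+1] averaging alone keeps the entries in the interval; this is the
     contraction lemma with constant [0]. *)
  move=> /subnK <-; rewrite fD.
  have := @stochastic_contract _ (S ^+ (m - k.+1 * N.+1)) (f (k.+1 * N.+1)%N)
    (lo k.+1) (hi k.+1) 0 j i (stochastic_pow _ SS).
  by rewrite !mul0r addr0 subr0; apply => //; have [] := stochastic_pow (m - k.+1 * N.+1) SS.
have lo_incr : nondecreasing_seq lo.
  apply/nondecreasing_seqP => k; rewrite /lo /= lerDl mulr_ge0 ?(ltW de0) // subr_ge0.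
  by case/andP: (bndf k (k * N.+1)%N j (leqnn _)).
have lo_hi k k' : lo k <= hi k'.
  have /andP[h _] := bndf k (maxn (k * N.+1) (k' * N.+1)) j (leq_maxl _ _).
  have /andP[_ h'] := bndf k' (maxn (k * N.+1) (k' * N.+1)) j (leq_maxr _ _).
  exact: le_trans h h'.
have lo_cvg : cvgn lo.
  by apply: nondecreasing_is_cvgn => //; exists (hi 0%N) => _ [k _ <-].
pose l := limn lo; exists l => i.
have lo_l k : lo k <= l by exact: nondecreasing_cvgn_le.
have l_hi k : l <= hi k by apply: limr_le => //; near=> n'.
have : tends (fun k => (1 - de) ^+ k) 0.
  by split; apply: cvg_expr; rewrite ger0_norm ?subr_ge0 // gtrBl.
move=> /tendsP w0; apply/tendsP => e /w0 [k Hk]; exists (k * N.+1)%N => m km.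
apply: le_trans (le_trans (ler_norm _) (Hk k (leqnn k))).
rewrite subr0 -width; have /andP[h1 h2] := bndf k m i km.
have := lo_l k; have := l_hi k; rewrite /f in h1 h2 *.
by rewrite ler_norml => ? ?; apply/andP; split; lra.
Unshelve. all: by end_near.
Qed.

(** Doob's transform: conjugating [B / rho] by the diagonal matrix of [v] gives a stochastic matrix
    [S] with a positive power. If [mu] is the common row of its limit, then [u] has entries
    [mu 0 j / v j 0], and its eigenvector properties are inherited from the limit. *)
Lemma perron_frobenius n (B : 'M[R]_n) rho (v : 'cV[R]_n) :
  (0 < n)%N -> (forall i j, 0 <= B i j) -> eventually_positive B ->
  B *m v = rho *: v -> (forall i, 0 < v i 0) ->
  0 < rho /\ exists u : 'rV[R]_n,
    [/\ forall j, 0 <= u 0 j, u *m B = rho *: u, u *m v = 1%:M &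
        forall i j, tends (fun m => (B ^+ m) i j / rho ^+ m) ((v *m u) i j)].
Proof.
move=> n0 B0 [N BN] Bv v0; pose i0 := Ordinal n0.
have Bvi m i : \sum_j (B ^+ m) i j * v j 0 = rho ^+ m * v i 0.
  by have := congr1 (fun M : 'cV_n => M i 0) (mulmx_eigen_pow m Bv); rewrite !mxE.
have rhoN : 0 < rho ^+ N.+1.
  rewrite -(pmulr_lgt0 _ (v0 i0)) -Bvi (bigD1 i0) //= ltr_wpDr //.
    by rewrite sumr_ge0 // => j _; rewrite mulr_ge0 // ltW // BN // leqnSn.
  by rewrite mulr_gt0 // BN.
have rho_ge0 : 0 <= rho.
  rewrite -(pmulr_lge0 _ (v0 i0)); have := Bvi 1%N i0; rewrite !expr1 => <-.
  by rewrite sumr_ge0 // => j _; rewrite mulr_ge0 // ltW.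
have rho0 : 0 < rho.
  rewrite lt_neqAle rho_ge0 andbT eq_sym; apply: contraTneq rhoN => ->.
  by rewrite expr0n ltxx.
split=> //; have rhoN0 m : rho ^+ m != 0 by rewrite gt_eqF ?exprn_gt0.
have v_ge0 i : 0 <= v i 0 by exact: ltW.
have vN0 i : v i 0 != 0 by rewrite gt_eqF.
pose S : 'M[R]_n := \matrix_(i, j) (B i j * v j 0 / (rho * v i 0)).
have SE m i j : (S ^+ m) i j = (B ^+ m) i j * v j 0 / (rho ^+ m * v i 0).
  elim: m i => [|m IHm] i.
    rewrite !expr0 mul1r !mxE; case: eqP => [->|_]; last by rewrite !mul0r.
    by rewrite mulfK.
  rewrite !exprS -!mulmxE !mxE !mulr_suml; apply: eq_bigr => k _.
  by rewrite IHm mxE; field; rewrite ?(gt_eqF rho0) ?rhoN0 ?vN0.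
have SS : stochastic S.
  split=> [i j|i]; first by rewrite mxE divr_ge0 ?mulr_ge0.
  under eq_bigr do rewrite mxE.
  have := Bvi 1%N i; rewrite !expr1 -mulr_suml => ->.
  by rewrite divff // mulf_neq0 // gt_eqF.
have SN i j : 0 < (S ^+ N.+1) i j.
  by rewrite SE divr_gt0 ?mulr_gt0 ?exprn_gt0 // BN.
have [mu Hmu] := stochastic_power_limit SS SN.
pose u : 'rV[R]_n := \row_j (mu 0 j / v j 0).
have lim i j : tends (fun m => (B ^+ m) i j / rho ^+ m) ((v *m u) i j).
  have H := tendsM (Hmu i j) (tends_cst (v i 0 / v j 0)).
  have -> : (v *m u) i j = mu 0 j * (v i 0 / v j 0).
    by rewrite !mxE big_ord1 !mxE; ring.
  apply: (tends_eq _ H) => m; rewrite SE.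
  by field; rewrite rhoN0 !vN0.
have vuE i j : (v *m u) i j = v i 0 * u 0 j by rewrite mxE big_ord1.
exists u; split=> // [j||].
- rewrite mxE divr_ge0 //; apply: (tends_ge0 _ (Hmu i0 j)) => m.
  by have [P0 _] := stochastic_pow m SS; exact: P0.
- apply/rowP => j.
  (* Reading B^(m+1) as B^m B gives two expressions for one limit; cancelling the positive entry
     [v i0 0] leaves the left eigenvector equation. *)
  have H1 : tends (fun m => \sum_k (B ^+ m) i0 k / rho ^+ m * B k j)
                  (\sum_k (v *m u) i0 k * B k j).
    by apply: tends_sum => k _; apply: tendsM (tends_cst _); exact: lim.
  have H2 : tends (fun m => rho * ((B ^+ m.+1) i0 j / rho ^+ m.+1)) (rho * (v *m u) i0 j).
    by apply: tendsM (tends_cst _) _; apply: (tends_succ (lim i0 j)).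
  have E : \sum_k (v *m u) i0 k * B k j = rho * (v *m u) i0 j.
    apply: (tends_unique H1); apply: (tends_eq _ H2) => m.
    rewrite exprSr -mulmxE mxE mulr_suml mulr_sumr; apply: eq_bigr => k _.
    by rewrite exprS; field; rewrite rhoN0 gt_eqF.
  rewrite [LHS]mxE [RHS]mxE; apply: (mulfI (vN0 i0)).
  rewrite mulrCA -vuE -E mulr_sumr; apply: eq_bigr => k _.
  by rewrite vuE mulrA.
- apply/matrixP => i j; rewrite !ord1 [RHS]mxE eqxx /= mulr1n [LHS]mxE.
  apply: (mulfI (vN0 i0)); rewrite mulr1.
  have H1 : tends (fun m => \sum_k (B ^+ m) i0 k / rho ^+ m * v k 0)
                  (\sum_k (v *m u) i0 k * v k 0).
    by apply: tends_sum => k _; apply: tendsM (tends_cst _); exact: lim.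
  rewrite mulr_sumr; under eq_bigr do rewrite mulrA -vuE.
  apply: (tends_unique H1); apply: (tends_eq _ (tends_cst (v i0 0))) => m.
  under [RHS]eq_bigr do rewrite mulrAC.
  by rewrite -mulr_suml Bvi mulrAC divff ?mul1r.
Qed.

(** The vector [y] equals B^m y / rho^m for every m, hence its limit. With [E] of the form [v *m u]
    this shows that the eigenspace is spanned by [v]. *)
Lemma eigenvector_limit n (B E : 'M[R]_n) rho (y : 'cV[R]_n) : rho != 0 ->
  (forall i j, tends (fun m => (B ^+ m) i j / rho ^+ m) (E i j)) ->
  B *m y = rho *: y -> y = E *m y.
Proof.
move=> rho0 BE By; apply/colP => i; rewrite [RHS]mxE.
have H : tends (fun m => \sum_j (B ^+ m) i j / rho ^+ m * y j 0) (\sum_j E i j * y j 0).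
  by apply: tends_sum => j _; apply: tendsM (BE i j) (tends_cst _).
apply: (tends_unique _ H); apply: (tends_eq _ (tends_cst (y i 0))) => m.
under eq_bigr do rewrite mulrAC.
rewrite -mulr_suml; have := congr1 (fun x : 'cV_n => x i 0) (mulmx_eigen_pow m By).
by rewrite !mxE => ->; rewrite mulrAC divff ?mul1r // expf_neq0.
Qed.

End Perron.

(** * The coefficient along the Perron eigenvector *)

(** Primary decomposition: the minimal polynomial divides the characteristic one, which divides the
    product over distinct roots of the coprime factors (X - z)^(n+1), since no multiplicity exceeds
    n+1. *)
Lemma geigenspace_full (C : closedFieldType) n (A : 'M[C]_n.+1) :
  exists (m : nat) (a : 'I_m -> C), (1%:M <= \sum_i geigenspace A (a i))%MS.
Proof.
have [rs] := closed_field_poly_normal (char_poly A).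
rewrite (monicP (char_poly_monic A)) scale1r => E.
have size_rs : size rs = n.+1.
  by have := size_char_poly A; rewrite E size_prod_XsubC => -[].
pose us := undup rs; exists (size us), (fun i => us`_i).
rewrite /geigenspace.
rewrite -(kermxpoly_prod A (P := xpredT) (p_ := fun i : 'I_(size us) => ('X - (us`_i)%:P) ^+ n.+1)).
  rewrite kermxpoly_min ?submx_refl //; apply: dvdp_trans (mxminpoly_dvd_char A) _.
  rewrite E -prodr_undup_exp_count.
  rewrite -(big_mkord xpredT (fun i => ('X - (us`_i)%:P) ^+ n.+1)).
  rewrite -(big_nth 0 xpredT (fun z => ('X - z%:P) ^+ n.+1)).
  apply: (big_ind2 (fun p q : {poly C} => p %| q)) => [||z _]; first exact: dvdpp.
    by move=> p1 q1 p2 q2; exact: dvdp_mul.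
  by rewrite dvdp_exp2l // -size_rs count_size.
move=> i j _ _ ij; apply/coprimep_expl/coprimep_expr/coprimep_XsubC2.
by rewrite subr_eq0 nth_uniq ?undup_uniq // (inj_eq val_inj) eq_sym.
Qed.

Section Coef.
Variable R : realType.

(** Applying [u] to (A - z)^n p = 0 gives (r - z)^n u p = 0, and z differs from r; so [u] kills each
    summand. *)
Lemma inVminus_left_eigen n (A : 'M[R]_n) r (u : 'rV[R]_n) (w : 'cV[R]_n) :
  u *m A = r *: u -> inVminus A r w -> u *m w = 0.
Proof.
move=> uA [s [/allP s_neq [/allP s_ker wE]]].
have UA : map_mx (@toC R) u *m map_mx (@toC R) A = toC r *: map_mx (@toC R) u.
  by rewrite -[LHS](map_mxM (real_complex R)) uA; exact: (map_mxZ (real_complex R)).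
apply: (@map_mx_inj _ _ (real_complex R)); rewrite map_mx0 (map_mxM (real_complex R)).
rewrite [X in _ *m X]wE mulmx_sumr big_seq big1 // => p ps.
have UAp : map_mx (@toC R) u *m (map_mx (@toC R) A - (p.1)%:M) = (toC r - p.1) *: map_mx (@toC R) u.
  by rewrite mulmxBr UA mul_mx_scalar scalerBl.
have := mulmx_left_eigen_pow n UAp => /(congr1 (mulmx^~ p.2)).
rewrite -mulmxA (eqP (s_ker _ ps)) mulmx0 -scalemxAl => /esym/eqP.
rewrite scalemx_eq0 expf_eq0 subr_eq0 eq_sym (negPf (s_neq _ ps)) andbF /=.
by move/eqP.
Qed.

Lemma trmxX (C : comNzRingType) n (A : 'M[C]_n) m : (A ^+ m)^T = A^T ^+ m.
Proof.
elim: m => [|m IHm]; first by rewrite !expr0 trmx1.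
by rewrite exprS exprSr -!mulmxE trmx_mul IHm.
Qed.

(** Converse of the preceding lemma. Split [w] into generalised eigenvectors; [u] kills [w] and all
    components outside [r], hence also the component [h] at [r]. Simplicity of the eigenvalue makes
    A - r injective on the kernel of [u], which forces [h] to vanish. *)
Lemma inVminus_complement n (A : 'M[R]_n) r (u : 'rV[R]_n) (v w : 'cV[R]_n) :
  (0 < n)%N -> u *m A = r *: u -> u *m v = 1%:M ->
  (forall y : 'cV[R]_n, A *m y = r *: y -> y = v *m (u *m y)) ->
  u *m w = 0 -> inVminus A r w.
Proof.
case: n A u v w => [//|n] A u v w _ uA uv simple uw.
pose f := real_complex R; pose AC := map_mx f A; pose U := map_mx f u.
(* Transposes appear because [geigenspace] consists of row vectors, whereas [inVminus] speaks of
   columns. *)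
have [m [a]] := geigenspace_full AC^T.
move=> /(submx_trans (submx1 (map_mx f w)^T)) /sub_sumsmxP [y yE].
pose g i := (y i *m geigenspace AC^T (a i))^T.
have gK i : (AC - (a i)%:M) ^+ n.+1 *m g i = 0.
  rewrite /g geigenspaceE -[_ ^+ _ in LHS]trmxK -trmx_mul trmxX linearB /= tr_scalar_mx.
  by rewrite -mulmxA mulmx_ker mulmx0 trmx0.
have gE : map_mx f w = \sum_i g i.
  by rewrite -[LHS]trmxK yE raddf_sum.
have UA : U *m AC = f r *: U by rewrite -map_mxM uA map_mxZ.
have UAp z : U *m (AC - z%:M) = (f r - z) *: U.
  by rewrite mulmxBr UA mul_mx_scalar scalerBl.
have Ug i : a i != f r -> U *m g i = 0.
  move=> ai; have := mulmx_left_eigen_pow n.+1 (UAp (a i)) => /(congr1 (mulmx^~ (g i))).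
  rewrite -mulmxA gK mulmx0 -scalemxAl => /esym/eqP.
  by rewrite scalemx_eq0 expf_eq0 subr_eq0 eq_sym (negPf ai) andbF /= => /eqP.
pose h := \sum_(i | a i == f r) g i.
have Uh : U *m h = 0.
  have : U *m map_mx f w = 0 by rewrite -map_mxM uw map_mx0.
  rewrite gE (bigID (fun i => a i == f r)) /= mulmxDr [X in _ + X]mulmx_sumr.
  by rewrite [X in _ + X]big1 ?addr0 // => i; exact: Ug.
have hK : (AC - (f r)%:M) ^+ n.+1 *m h = 0.
  by rewrite mulmx_sumr big1 // => i /eqP <-.
(* On ker u the singular matrix A - r coincides with this invertible one. *)
pose M := A - r%:M + v *m u.
have M_unit : M \in unitmx.
  rewrite -unitmx_tr -row_free_unit -kermx_eq0; apply/eqP/row_matrixP => i.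
  set z := row i _; rewrite row0.
  have : z *m M^T = 0 by rewrite /z -row_mul mulmx_ker row0.
  move/(congr1 trmx); rewrite trmx_mul trmxK trmx0; set x := z^T => Mx.
  have ux : u *m x = 0.
    have := congr1 (mulmx u) Mx; rewrite mulmx0 mulmxA /M mulmxDr mulmxBr uA.
    by rewrite mul_mx_scalar subrr add0r mulmxA uv mul1mx.
  have : A *m x = r *: x.
    move: Mx; rewrite /M mulmxDl mulmxBl -mulmxA ux mulmx0 addr0 mul_scalar_mx.
    by move/eqP; rewrite subr_eq0 => /eqP.
  by move/simple; rewrite ux mulmx0 => x0; rewrite -[z]trmxK -/x x0 trmx0.
have MC_pow j (x : 'cV_n.+1) : U *m x = 0 ->
    map_mx f M ^+ j *m x = (AC - (f r)%:M) ^+ j *m x.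
  elim: j x => [//|j IHj] x Ux; rewrite !exprSr -!mulmxE -!mulmxA.
  have -> : map_mx f M *m x = (AC - (f r)%:M) *m x.
    by rewrite /M map_mxD map_mxB map_scalar_mx map_mxM mulmxDl -mulmxA Ux mulmx0 addr0.
  by rewrite IHj // mulmxA UAp subrr scale0r mul0mx.
have h0 : h = 0.
  have MU : map_mx f M ^+ n.+1 \in unitmx.
    by apply: (@unitrX 'M_n.+1); rewrite -[_ \is a _]/(_ \in unitmx) map_unitmx.
  by rewrite -(mulKmx MU h) MC_pow // hK mulmx0.
exists [seq (a i, g i) | i <- index_enum 'I_m & a i != f r]; split.
  by apply/allP => _ /mapP[i + ->]; rewrite mem_filter => /andP[].
split; first by apply/allP => _ /mapP[i _ ->] /=; rewrite gK.
by rewrite big_map big_filter /= [LHS]gE (bigID (fun i => a i == f r)) /= -/h h0 add0r.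
Qed.

(** The kernel of [u] is exactly the space V^-, so subtracting (u x) v from [x] gives a
    decomposition; hence [xget] returns a genuine coefficient, and applying [u] identifies it. *)
Lemma coef_left_eigen n (A : 'M[R]_n) r (u : 'rV[R]_n) (v x : 'cV[R]_n) :
  (0 < n)%N -> u *m A = r *: u -> u *m v = 1%:M ->
  (forall y : 'cV[R]_n, A *m y = r *: y -> y = v *m (u *m y)) ->
  coef A r v x = (u *m x) 0 0.
Proof.
move=> n0 uA uv simple.
have scal (a : R) : (u *m (a *: v)) 0 0 = a by rewrite -scalemxAr uv !mxE mulr1.
have [w [wV xE]] : exists w, inVminus A r w /\ x = coef A r v x *: v + w.
  apply: (@xgetPex _ 0 (fun a => exists w, inVminus A r w /\ x = a *: v + w)).
  exists ((u *m x) 0 0), (x - (u *m x) 0 0 *: v); split; last by rewrite addrC subrK.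
  apply: (inVminus_complement n0 uA uv simple).
  by rewrite mulmxBr -scalemxAr uv scalemx1 -mx11_scalar subrr.
by rewrite [in RHS]xE mulmxDr (inVminus_left_eigen uA wV) addr0 scal.
Qed.

End Coef.

(** * Path expansion *)

Section Blocks.
Variables (R : realType) (d k : nat) (dk : 'I_k -> nat).
Hypothesis sum_dk : (\sum_(i < k) dk i)%N = d.
Variable Q : 'M[R]_d.

Local Notation block := (block d dk).

(** Columns are the coordinate vectors of the block. Blocks of [Q] and projections thereby become
    products with this matrix, which confines the dependent dimension [#|block i|]. *)
Definition block_emb (i : 'I_k) : 'M[R]_(d, #|block i|) :=
  \matrix_(x, a) (x == enum_val a)%:R.

Lemma mulmx_emb m (A : 'M[R]_(m, d)) i x a : (A *m block_emb i) x a = A x (enum_val a).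
Proof.
rewrite mxE (bigD1 (enum_val a)) //= mxE eqxx mulr1 big1 ?addr0 // => y /negPf yN.
by rewrite mxE yN mulr0.
Qed.

Lemma mulmx_emb_tr m (A : 'M[R]_(d, m)) i a y : ((block_emb i)^T *m A) a y = A (enum_val a) y.
Proof. by rewrite -[_ *m _]trmxK trmx_mul trmxK mxE mulmx_emb mxE. Qed.

Lemma sum_dk_mono (p q : pred 'I_k) : (forall i, p i -> q i) ->
  (\sum_(i < k | p i) dk i <= \sum_(i < k | q i) dk i)%N.
Proof.
move=> pq; rewrite big_mkcond [leqRHS]big_mkcond /=; apply: leq_sum => i _.
by case: ifP => [/pq ->|].
Qed.

Lemma block_disjoint i j x : x \in block i -> x \in block j -> i = j.
Proof.
wlog ij : i j / (i <= j)%N.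
  by move=> H xi xj; case/orP: (leq_total i j) => ?; [|symmetry]; exact: H.
rewrite !inE => /andP[_ xi] /andP[xj _]; apply/val_inj/eqP => /=.
rewrite eqn_leq ij leqNgt /=; apply/negP => lt_ij.
have : (\sum_(i0 < k | (i0 <= i)%N) dk i0 <= \sum_(i0 < k | (i0 < j)%N) dk i0)%N.
  by apply: sum_dk_mono => i0 /leq_ltn_trans; apply.
by move/(leq_trans xi)/leq_trans/(_ xj); rewrite ltnn.
Qed.

Lemma block_cover (x : 'I_d) : exists i, x \in block i.
Proof.
pose S m := (\sum_(i < k | (i < m)%N) dk i)%N.
have Sk : (x < S k)%N by rewrite /S (eq_bigl xpredT) ?sum_dk // => i; rewrite ltn_ord.
have [m Sm min_m] := ex_minnP (ex_intro (fun m => x < S m)%N k Sk).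
case: m Sm min_m => [|m] Sm min_m.
  by move: Sm; rewrite /S big_pred0.
have mk : (m < k)%N by rewrite -ltnS; apply: leq_ltn_trans (min_m _ Sk) _.
exists (Ordinal mk); rewrite inE /=; apply/andP; split; last exact: Sm.
by rewrite leqNgt; apply/negP => /min_m; rewrite ltnn.
Qed.

Lemma emb_trK i : (block_emb i)^T *m block_emb i = 1%:M.
Proof. by apply/matrixP => a b; rewrite mulmx_emb !mxE (inj_eq enum_val_inj) eq_sym. Qed.

Lemma emb_tr_neq i j : i != j -> (block_emb i)^T *m block_emb j = 0.
Proof.
move=> /eqP ij; apply/matrixP => a b; rewrite mulmx_emb !mxE.
case: eqP => // E; case: ij; apply: (@block_disjoint i j (enum_val b)); last exact: enum_valP.
by rewrite E enum_valP.
Qed.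

Lemma blk_emb i j : blk dk Q i j = (block_emb i)^T *m Q *m block_emb j.
Proof. by apply/matrixP => a b; rewrite mulmx_emb mulmx_emb_tr mxE. Qed.

Lemma blkrow_emb (pi : 'rV[R]_d) i : blkrow dk pi i = pi *m block_emb i.
Proof. by apply/matrixP => a b; rewrite mulmx_emb !mxE ord1. Qed.

Lemma emb_tr_const i c : (block_emb i)^T *m const_mx c = const_mx c :> 'cV_(#|block i|).
Proof. by apply/matrixP => a b; rewrite mulmx_emb_tr !mxE. Qed.

Definition block_proj i : 'M[R]_d := block_emb i *m (block_emb i)^T.

Lemma proj_emb i : block_proj i *m block_emb i = block_emb i.
Proof. by rewrite /block_proj -mulmxA emb_trK mulmx1. Qed.

Lemma projE i x y : block_proj i x y = ((x == y) && (x \in block i))%:R.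
Proof.
rewrite mxE; have [xi|xNi] := boolP (x \in block i); last first.
  rewrite andbF big1 // => a _; rewrite mxE; case: eqP => [E|]; last by rewrite mul0r.
  by move: xNi; rewrite E enum_valP.
rewrite (bigD1 (enum_rank_in xi x)) //= !mxE enum_rankK_in // eqxx mul1r andbT eq_sym.
rewrite big1 ?addr0 // => a aN; rewrite !mxE; have [E|] := eqVneq x (enum_val a); last by rewrite mul0r.
by case/eqP: aN; apply: enum_val_inj; rewrite enum_rankK_in.
Qed.

Lemma proj_id i : block_proj i *m block_proj i = block_proj i.
Proof. by rewrite {2}/block_proj mulmxA proj_emb. Qed.

Lemma proj_neq i j : i != j -> block_proj i *m block_proj j = 0.
Proof. by move=> ij; rewrite /block_proj mulmxA -(mulmxA (block_emb i)) emb_tr_neq // mulmx0 mul0mx. Qed.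

Lemma sum_proj : \sum_i block_proj i = 1%:M.
Proof.
apply/matrixP => x y; rewrite summxE mxE; have [i xi] := block_cover x.
rewrite (bigD1 i) //= projE xi andbT big1 ?addr0 // => j jNi.
rewrite projE; case: (boolP (x \in block j)) => [xj|]; last by rewrite andbF.
by rewrite (block_disjoint xi xj) eqxx in jNi.
Qed.

Lemma proj_Q_proj i j : block_proj i *m Q *m block_proj j = block_emb i *m blk dk Q i j *m (block_emb j)^T.
Proof. by rewrite blk_emb /block_proj !mulmxA. Qed.

(** The [n]-step kernel of the chain confined to block [i], as a matrix on all transient states, so
    that kernels of different blocks can be composed. *)
Definition block_ker i n : 'M[R]_d := block_emb i *m blk dk Q i i ^+ n *m (block_emb i)^T.

Lemma ker0 i : block_ker i 0 = block_proj i. Proof. by rewrite /block_ker expr0 mulmx1. Qed.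

Lemma kerS i n : block_ker i n.+1 = block_proj i *m Q *m block_ker i n.
Proof. by rewrite /block_ker exprS -mulmxE {1}blk_emb /block_proj !mulmxA. Qed.

Lemma proj_ker i n : block_proj i *m block_ker i n = block_ker i n.
Proof. by rewrite /block_ker !mulmxA proj_emb. Qed.

Definition linked (i j : 'I_k) : bool := (j < i)%N && (blk dk Q i j != 0).

Lemma sorted_enum_set (A : {set 'I_k}) : sorted (fun a b : 'I_k => (a < b)%N) (enum A).
Proof.
rewrite /enum_mem; apply: sorted_filter; first by move=> a b c; exact: ltn_trans.
have : sorted ltn (map val (enum 'I_k)) by rewrite val_enum_ord iota_ltn_sorted.
by rewrite sorted_map enumT.
Qed.

(** An admissible path is strictly decreasing, so it coincides with the decreasing enumeration of
    its set of entries. *)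
Lemma mem_allPaths th : (th \in allPaths dk Q) = admissible dk Q th.
Proof.
rewrite mem_filter andb_idr // => /andP[_ th_sorted].
apply/mapP; exists [set i in th]; first by rewrite mem_enum inE.
have gt_tr : transitive (fun a b : 'I_k => (b < a)%N).
  by move=> a b c ab ca; exact: ltn_trans ca ab.
apply: (irr_sorted_eq gt_tr) => [i|||i]; first exact: ltnn.
- by apply: sub_sorted th_sorted => a b /andP[].
- by rewrite /pathOf rev_sorted sorted_enum_set.
- by rewrite /pathOf mem_rev mem_enum inE.
Qed.

Lemma allPaths_uniq : uniq (allPaths dk Q).
Proof.
apply: filter_uniq; rewrite map_inj_uniq ?enum_uniq // => A B /(congr1 rev).
rewrite /pathOf !revK => AB; apply/setP => i.
by rewrite -(mem_enum A) AB mem_enum.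
Qed.

Lemma sum_allPaths_single (V : nmodType) (G : 'I_k -> V) :
  \sum_(th <- allPaths dk Q) (if th is [:: i] then G i else 0) = \sum_i G i.
Proof.
rewrite (bigID (fun th => size th == 1%N)) /= [X in _ + X]big1 ?addr0; last first.
  by move=> [|i [|j t]].
rewrite -big_filter (perm_big [seq [:: i] | i <- enum 'I_k]) /=.
  by rewrite big_map big_enum.
apply: uniq_perm; first by rewrite filter_uniq // allPaths_uniq.
  by rewrite map_inj_uniq ?enum_uniq // => i j [].
move=> th; rewrite mem_filter mem_allPaths; apply/andP/mapP => [[]|[i _ ->] //].
by case: th => [|i [|j t]] // _ _; exists i; rewrite ?mem_enum.
Qed.

(** Paths with at least two blocks correspond bijectively to an admissible tail together with a
    block linked to the head of that tail. *)
Lemma sum_allPaths_cons (V : nmodType) (G : 'I_k -> seq 'I_k -> V) :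
  \sum_(th <- allPaths dk Q) (if th is i :: ((_ :: _) as t) then G i t else 0) =
  \sum_(t <- allPaths dk Q) \sum_(i | if t is j :: _ then linked i j else false) G i t.
Proof.
pose step t := [seq i <- enum 'I_k | if t is j :: _ then linked i j else false].
transitivity (\sum_(th <- [seq i :: t | t <- allPaths dk Q, i <- step t])
    (if th is i :: ((_ :: _) as t) then G i t else 0)); last first.
  rewrite big_allpairs_dep; apply: eq_bigr => -[|j t] _.
    by rewrite big_filter !big1.
  by rewrite big_filter big_enum_cond.
rewrite (bigID (fun th => 1 < size th)%N) /= [X in _ + X]big1 ?addr0; last first.
  by move=> [|i [|j t]].
rewrite -big_filter; apply: perm_big; apply: uniq_perm.
- by rewrite filter_uniq // allPaths_uniq.
- apply: allpairs_uniq_dep; first exact: allPaths_uniq.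
    by move=> t _; rewrite filter_uniq ?enum_uniq.
  by move=> [t i] [t' i'] _ _ /= [-> ->].
move=> th; rewrite mem_filter mem_allPaths; apply/andP/allpairsPdep.
  case: th => [|i [|j t]] [] // _ /andP[_ /= /andP[ij jt]].
  exists (j :: t), i; split=> //; last by rewrite mem_filter mem_enum /linked ij.
  by rewrite mem_allPaths.
move=> [t [i [tP]]]; rewrite mem_filter; case: t tP => // j t.
rewrite mem_allPaths => /andP[_ jt] /andP[ij _] ->; split=> //.
by apply/andP; split=> //=; apply/andP.
Qed.

End Blocks.

(** * Solving the linear recursion path by path *)

Section PathSolutions.
Variables (R : realType) (d k : nat) (dk : 'I_k -> nat) (Q : 'M[R]_d).
Hypothesis sum_dk : (\sum_(i < k) dk i)%N = d.
Hypothesis Q_lower : forall i j : 'I_k, (i < j)%N -> blk dk Q i j = 0.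
Implicit Types (F : seq 'I_k -> nat -> 'cV[R]_d) (th t : seq 'I_k).

Local Notation block_emb := (@block_emb R d k dk).
Local Notation block_proj := (@block_proj R d k dk).
Local Notation block_ker := (@block_ker R d k dk Q).
Local Notation linked := (@linked R d k dk Q).
Local Notation paths := (allPaths dk Q).

(* Contribution of a single path to the solution [X] of
   [X (n + 1) = Q X n + sum of F over all paths]. *)
Fixpoint pathsol F th n : 'cV[R]_d :=
  if th is i :: t then
    \sum_(m < n.+1) block_ker i (n - m) *m
      (F th m + (if nat_of_ord m is m'.+1 then Q *m pathsol F t m' else 0))
  else 0.

Lemma pathsol_cons F i t n : pathsol F (i :: t) n =
  \sum_(m < n.+1) block_ker i (n - m) *m
      (F (i :: t) m + (if nat_of_ord m is m'.+1 then Q *m pathsol F t m' else 0)).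
Proof. by []. Qed.

Arguments pathsol : simpl never.

Lemma proj_pathsol F i t n : block_proj i *m pathsol F (i :: t) n = pathsol F (i :: t) n.
Proof.
rewrite pathsol_cons mulmx_sumr; apply: eq_bigr => m _.
by rewrite mulmxA proj_ker.
Qed.

Lemma pathsol0 F i t : pathsol F (i :: t) 0 = block_proj i *m F (i :: t) 0%N.
Proof. by rewrite pathsol_cons big_ord1 ker0 addr0. Qed.

Lemma pathsolS F i t n : pathsol F (i :: t) n.+1 =
  block_proj i *m Q *m pathsol F (i :: t) n + block_proj i *m F (i :: t) n.+1
  + block_proj i *m Q *m pathsol F t n.
Proof.
rewrite pathsol_cons big_ord_recr /= subnn ker0 mulmxDr mulmxA addrA; congr (_ + _ + _).
rewrite pathsol_cons mulmx_sumr; apply: eq_bigr => m _.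
by rewrite subSn -1?ltnS // kerS !mulmxA.
Qed.

Lemma proj_Q_step i j : i != j -> ~~ linked i j -> block_proj i *m Q *m block_proj j = 0.
Proof.
rewrite proj_Q_proj /linked negb_and -leqNgt negbK leq_eqVlt => ij.
case/orP=> [/orP[/eqP/val_inj E|/Q_lower ->]|/eqP ->]; rewrite ?mulmx0 ?mul0mx //.
by rewrite E eqxx in ij.
Qed.

(** The source of a path lives in its first block. Since [pathsol] projects its source onto that
    block, this ensures that nothing is lost. *)
Definition headed F := forall i t n, block_proj i *m F (i :: t) n = F (i :: t) n.

Definition path_total F n := \sum_(th <- paths) pathsol F th n.

Lemma nil_notin_paths : [::] \notin paths.
Proof. by rewrite mem_allPaths. Qed.

Lemma path_total0 F : headed F -> path_total F 0 = \sum_(th <- paths) F th 0%N.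
Proof.
move=> FH; rewrite /path_total big_seq [RHS]big_seq; apply: eq_bigr => -[|i t] th.
  by have := nil_notin_paths; rewrite th.
by rewrite pathsol0 FH.
Qed.

(** Applying [Q] to the solution of a path that starts in block [j] yields a part that stays in [j]
    and parts that enter blocks linked to [j]. The former continues the same path, the latter feed
    the paths with one more block in front. *)
Lemma path_totalS F n : headed F ->
  path_total F n.+1 = Q *m path_total F n + \sum_(th <- paths) F th n.+1.
Proof.
move=> FH; pose Y th := pathsol F th n.
pose own th := if th is i :: _ then block_proj i *m Q *m Y th else 0.
pose inc th := if th is i :: ((_ :: _) as t) then block_proj i *m Q *m Y t else 0.
have -> : path_total F n.+1 = \sum_(th <- paths) (own th + F th n.+1 + inc th).
  rewrite /path_total big_seq [RHS]big_seq; apply: eq_bigr => -[|i t] th.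
    by have := nil_notin_paths; rewrite th.
  by rewrite pathsolS FH /own /inc; case: t th => //=; rewrite mulmx0.
rewrite !big_split /= addrAC; congr (_ + _).
rewrite (sum_allPaths_cons _ _ (fun i t => block_proj i *m Q *m Y t)) -big_split /=.
rewrite /path_total mulmx_sumr big_seq [RHS]big_seq; apply: eq_bigr => -[|j t] th.
  by have := nil_notin_paths; rewrite th.
(* The identity, as the sum of all block projections, is inserted to the left of [Q]; only [i = j]
   and the linked blocks survive. *)
rewrite -[in RHS](mul1mx Q) -(sum_proj R sum_dk) !mulmx_suml [RHS](bigD1 j) //=.
congr (_ + _); rewrite [RHS](bigID (fun i => linked i j)) /= [X in _ = _ + X]big1 ?addr0.
  apply: eq_bigl => i; rewrite andb_idl // => /andP[ji _].
  by rewrite -val_eqE gtn_eqF.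
move=> i /andP[ij ijN]; rewrite -proj_pathsol mulmxA proj_Q_step //.
by rewrite mul0mx.
Qed.

Definition surv_src th n : 'cV[R]_d :=
  if th is [:: i] then (if n is 0 then block_proj i *m const_mx 1 else 0) else 0.

Definition path_survival := pathsol surv_src.

Lemma surv_src_headed : headed surv_src.
Proof.
by move=> i [|j t] [|n] /=; rewrite ?mulmx0 // mulmxA proj_id.
Qed.

Lemma path_total_surv n : path_total surv_src n = Q ^+ n *m const_mx 1.
Proof.
elim: n => [|n IHn].
  rewrite path_total0; last exact: surv_src_headed.
  rewrite (sum_allPaths_single _ _ (fun i => block_proj i *m const_mx 1)).
  by rewrite -mulmx_suml sum_proj.
rewrite path_totalS ?IHn; last exact: surv_src_headed.
rewrite exprS -mulmxE mulmxA big1 ?addr0 //; by move=> [|i [|j t]].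
Qed.

(** The survival solution is injected afresh whenever the path starts in block [l]. A path through
    [l] is thus traversed with two kernels of that block, one before and one after the marked
    time. *)
Definition occ_src (l : 'I_k) th n : 'cV[R]_d :=
  if th is i :: _ then (if i == l then path_survival th n else 0) else 0.

Definition path_occupation l := pathsol (occ_src l).

Lemma occ_src_headed l : headed (occ_src l).
Proof.
move=> i t n; rewrite /occ_src; case: eqP => _; last by rewrite mulmx0.
exact: proj_pathsol.
Qed.

Lemma sum_occ_src l n :
  \sum_(th <- paths) occ_src l th n = block_proj l *m Q ^+ n *m const_mx 1.
Proof.
rewrite -mulmxA -path_total_surv /path_total mulmx_sumr big_seq [RHS]big_seq.
apply: eq_bigr => -[|i t] th; first by have := nil_notin_paths; rewrite th.
rewrite /= -proj_pathsol mulmxA; have [->|il] := eqVneq i l.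
  by rewrite proj_id proj_pathsol.
by rewrite proj_neq 1?eq_sym // mul0mx.
Qed.

(** Both sides solve the same recursion, with source [block_proj l *m Q ^+ n *m const_mx 1]. *)
Lemma path_total_occ l n : path_total (occ_src l) n =
  \sum_(m < n.+1) Q ^+ (n - m) *m block_proj l *m Q ^+ m *m const_mx 1.
Proof.
elim: n => [|n IHn].
  rewrite path_total0; last exact: occ_src_headed.
  by rewrite sum_occ_src big_ord1 expr0 mul1mx.
rewrite path_totalS ?IHn; last exact: occ_src_headed.
rewrite sum_occ_src [RHS]big_ord_recr /= subnn mul1mx; congr (_ + _).
rewrite mulmx_sumr; apply: eq_bigr => m _.
by rewrite subSn -1?ltnS // exprS -mulmxE !mulmxA.
Qed.

Lemma occ_notin l th n : l \notin th -> path_occupation l th n = 0.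
Proof.
elim: th n => [//|i t IHt] n; rewrite inE negb_or eq_sym => /andP[il lt].
rewrite /path_occupation pathsol_cons big1 // => m _; rewrite /= (negPf il) add0r.
by case: (nat_of_ord m) => [|m']; rewrite -?/(path_occupation _ _ _) ?IHt ?mulmx0.
Qed.

End PathSolutions.

(** * Asymptotics of the path expansion *)

Section Asymptotics.
Variables (R : realType) (d k : nat) (dk : 'I_k -> nat) (Q : 'M[R]_d).
Variables (M : R) (rho : 'I_k -> R).
Variables (v : forall i, 'cV[R]_#|block d dk i|) (u : forall i, 'rV[R]_#|block d dk i|).
Hypothesis Q_ge0 : forall x y, 0 <= Q x y.
Hypothesis rho_gt0 : forall i, 0 < rho i.
Hypothesis rho_le : forall i, rho i <= M.
Hypothesis M_gt0 : 0 < M.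
Hypothesis v_gt0 : forall i a, 0 < v i a 0.
Hypothesis u_ge0 : forall i a, 0 <= u i 0 a.
Hypothesis uv1 : forall i, u i *m v i = 1%:M.
Hypothesis blk_v : forall i, blk dk Q i i *m v i = rho i *: v i.
Hypothesis blk_lim : forall i a b,
  tends (fun m => (blk dk Q i i ^+ m) a b / rho i ^+ m) ((v i *m u i) a b).
Hypothesis blk_scalar : forall i, rho i < M -> is_scalar_mx (blk dk Q i i).

Local Notation block_emb := (@block_emb R d k dk).
Local Notation block_proj := (@block_proj R d k dk).
Local Notation block_ker := (@block_ker R d k dk Q).

Definition vemb i : 'cV[R]_d := block_emb i *m v i.
Definition uemb i : 'rV[R]_d := u i *m (block_emb i)^T.

Lemma uemb_vemb i : uemb i *m vemb i = 1%:M.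
Proof. by rewrite /uemb mulmxA -(mulmxA (u i)) emb_trK mulmx1 uv1. Qed.

Lemma blk_pow_ge0 i n a b : 0 <= (blk dk Q i i ^+ n) a b.
Proof.
elim: n a b => [|n IHn] a b; first by rewrite mxE; case: (_ == _).
by rewrite exprS -mulmxE mxE sumr_ge0 // => c _; rewrite mulr_ge0 // mxE.
Qed.

Lemma emb_ge0 i x a : 0 <= block_emb i x a.
Proof. by rewrite mxE ler0n. Qed.

Lemma mulmx_ge0 p q r (A : 'M[R]_(p, q)) (B : 'M[R]_(q, r)) :
  (forall i j, 0 <= A i j) -> (forall i j, 0 <= B i j) ->
  forall i j, 0 <= (A *m B) i j.
Proof. by move=> A0 B0 i j; rewrite mxE sumr_ge0 // => m _; rewrite mulr_ge0. Qed.

Lemma ker_ge0 i n x y : 0 <= block_ker i n x y.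
Proof.
apply: mulmx_ge0 => [{}x a|a {}y]; last by rewrite mxE emb_ge0.
apply: mulmx_ge0; [exact: emb_ge0 | exact: blk_pow_ge0].
Qed.

Lemma ker_lim i x y :
  tends (fun n => block_ker i n x y / rho i ^+ n) ((vemb i *m uemb i) x y).
Proof.
pose c b a := block_emb i x a * (block_emb i)^T b y.
have E (A : 'M[R]_#|block d dk i|) :
    (block_emb i *m A *m (block_emb i)^T) x y = \sum_b \sum_a c b a * A a b.
  rewrite mxE; apply: eq_bigr => b _; rewrite mxE mulr_suml; apply: eq_bigr => a _.
  by rewrite /c mulrAC.
rewrite /vemb /uemb mulmxA -(mulmxA (block_emb i)) E.
have : tends (fun n => \sum_b \sum_a c b a * ((blk dk Q i i ^+ n) a b / rho i ^+ n))
             (\sum_b \sum_a c b a * (v i *m u i) a b).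
  apply: tends_sum => b _; apply: tends_sum => a _.
  exact: tendsM (tends_cst _) (blk_lim a b).
apply: tends_eq => n; rewrite /block_ker E mulr_suml; apply: eq_bigr => b _.
by rewrite mulr_suml; apply: eq_bigr => a _; rewrite mulrA.
Qed.

Lemma ker_small i n : rho i < M -> block_ker i n = rho i ^+ n *: block_proj i.
Proof.
move=> /blk_scalar /is_scalar_mxP [c cE].
have crho : c = rho i.
  have := blk_v i; rewrite cE mul_scalar_mx => /(congr1 (mulmx (u i))).
  by rewrite -!scalemxAr uv1 !scalemx1 => /matrixP /(_ 0 0); rewrite !mxE.
rewrite /block_ker; have -> : blk dk Q i i ^+ n = (rho i ^+ n)%:M.
  rewrite cE crho; elim: n => [|n IHn]; first by rewrite !expr0.
  by rewrite exprS -mulmxE IHn -scalar_mxM -exprS.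
by rewrite mul_mx_scalar -scalemxAl.
Qed.

(** For a scalar block the rescaled kernel is constantly the projection, which is therefore its
    rank-one limit. This lets top and lower blocks share one formula. *)
Lemma proj_small i : rho i < M -> vemb i *m uemb i = block_proj i.
Proof.
move=> ri; apply/matrixP => x y; apply: (tends_unique (ker_lim i x y)).
apply: (tends_eq _ (tends_cst (block_proj i x y))) => n.
by rewrite ker_small // [(_ *: block_proj i) x y]mxE mulrAC divff ?mul1r // expf_neq0 // gt_eqF.
Qed.

Definition vasym p (W : nat -> 'cV[R]_d) (L : 'cV[R]_d) :=
  forall x, asym p (fun n => W n x 0 / M ^+ n) (L x 0).

Definition is_top i : nat := rho i == M.
(** For a lower block, the sum of the geometric series of ratio [rho i / M]. *)
Definition block_gain i : R := if rho i == M then 1 else M / (M - rho i).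

(** After division by M^n the sum is a convolution. For a top block the kernel converges to a
    rank-one matrix and the order rises by one; for a lower block the kernel is a geometric filter
    on the block and the order stays. *)
Lemma vasym_ker i p g G : vasym p g G ->
  vasym (is_top i + p) (fun n => \sum_(m < n.+1) block_ker i (n - m) *m g m)
        ((block_gain i * (uemb i *m G) 0 0) *: vemb i).
Proof.
move=> gG x.
pose b y n := block_ker i n x y / M ^+ n.
have convE n : (\sum_(m < n.+1) block_ker i (n - m) *m g m) x 0 / M ^+ n =
    \sum_y conv (b y) (fun m => g m y 0 / M ^+ m) n.
  rewrite summxE mulr_suml exchange_big /=; apply: eq_bigr => m _.
  rewrite mxE mulr_suml; apply: eq_bigr => y _.
  have /subnK E : (m <= n)%N by rewrite -ltnS.
  rewrite /b -[in M ^+ n]E exprD; have ? : M != 0 by rewrite gt_eqF.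
  by field; rewrite !expf_neq0.
have limE : (vemb i *m uemb i *m G) x 0 = (uemb i *m G) 0 0 * vemb i x 0.
  by rewrite -mulmxA mxE big_ord1 mulrC.
rewrite [X in asym _ _ X]mxE -mulrA -limE mxE.
rewrite /is_top /block_gain; have [riM|riNM] := eqVneq (rho i) M.
  rewrite add1n mul1r; have H y : asym p.+1 (conv (b y) (fun m => g m y 0 / M ^+ m))
      ((vemb i *m uemb i) x y * G y 0).
    apply: asym_conv_cvg => [n||]; last exact: gG.
      by rewrite divr_ge0 ?ker_ge0 // exprn_ge0 // ltW.
    by apply: tends_eq (ker_lim i x y) => n; rewrite riM.
  have := @asym_sum R p.+1 _ (index_enum 'I_d) xpredT (fun=> 1) _ _ (fun=> fun=> ler01) (fun y _ => H y).
  under [X in asym _ _ X]eq_bigr do rewrite mul1r.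
  by apply: asym_eq => n; rewrite convE; under eq_bigr do rewrite mul1r.
have riM : rho i < M by rewrite lt_neqAle riNM rho_le.
rewrite add0n proj_small //; pose q := rho i / M.
have q01 : 0 <= q < 1.
  by rewrite divr_ge0 ?ltW //= ltr_pdivrMr // mul1r.
have H y := asym_conv_geo q01 (gG y).
have := @asym_sum R p _ (index_enum 'I_d) xpredT (fun y => block_proj i x y) _ _ _ (fun y _ => H y).
have -> : \sum_y block_proj i x y * ((1 - q)^-1 * G y 0) =
          M / (M - rho i) * \sum_y block_proj i x y * G y 0.
  rewrite mulr_sumr; apply: eq_bigr => y _; rewrite /q; field.
  by rewrite subr_eq0 eq_sym riNM gt_eqF.
move=> /(_ (fun y _ => ltac:(by rewrite projE ler0n))).
apply: asym_eq => n; rewrite convE; apply: eq_bigr => y _.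
rewrite /conv mulr_sumr; apply: eq_bigr => m _; rewrite /b ker_small // [(_ *: block_proj i) x y]mxE /q expr_div_n.
by rewrite mulrA; congr (_ * _); rewrite mulrA [block_proj _ _ _ * _]mulrC.
Qed.

Lemma vasym_shift p g G : vasym p g G ->
  vasym p (fun n => if n is m.+1 then Q *m g m else 0) (M^-1 *: (Q *m G)).
Proof.
move=> gG x.
have := @asym_sum R p _ (index_enum 'I_d) xpredT (fun y => M^-1 * Q x y) _ _ _ (fun y _ => gG y).
move=> /(_ (fun y _ => ltac:(by rewrite mulr_ge0 // invr_ge0 ltW))) /asym_delay.
have <- : \sum_y M^-1 * Q x y * G y 0 = (M^-1 *: (Q *m G)) x 0.
  by rewrite !mxE mulr_sumr; apply: eq_bigr => y _; rewrite mulrA.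
apply: asym_eq => -[|n] /=; first by rewrite mxE mul0r.
rewrite mxE mulr_suml; apply: eq_bigr => y _.
by rewrite exprS; field; rewrite expf_neq0 gt_eqF.
Qed.

Hypothesis coefE : forall i x, coef (blk dk Q i i) (rho i) (v i) x = (u i *m x) 0 0.

Local Notation path_survival := (@path_survival R d k dk Q).
Local Notation path_occupation := (@path_occupation R d k dk Q).

Lemma vasym_eq p (W W' : nat -> 'cV[R]_d) L L' : W =1 W' -> L = L' ->
  vasym p W L -> vasym p W' L'.
Proof. by move=> /funext -> ->. Qed.

Definition top_count th := count (fun i => rho i == M) th.

Definition head_vec (th : seq 'I_k) : 'cV[R]_d := if th is i :: _ then vemb i else 0.

Fixpoint path_coef (th : seq 'I_k) : R :=
  match th with
  | [::] => 0
  | [:: i] => block_gain i * alpha_end Q rho v i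
  | i :: ((j :: _) as t) => block_gain i / M * alpha_step Q rho v i j * path_coef t
  end.

(** Counting powers of [M]: each lower block gives one, each link takes one away. As there is one
    link fewer than blocks, the net exponent is one minus the number of top blocks. *)
Lemma path_coef_weight th : th != [::] -> M ^+ top_count th * path_coef th =
  M * alpha_path dk Q rho v th * \prod_(j <- th | rho j < M) (M - rho j)^-1.
Proof.
have M0 : M != 0 by rewrite gt_eqF.
elim: th => [//|i [|j t] IHt] _.
  rewrite big_cons big_nil /top_count /= /block_gain addn0; have [->|riM] := eqVneq (rho i) M.
    by rewrite ltxx expr1; ring.
  by rewrite lt_neqAle riM rho_le /=; ring.
rewrite big_cons; set pc := path_coef _; have {pc}-> : pc = block_gain i / M * alpha_step Q rho v i j * path_coef (j :: t) by [].
set ap := alpha_path _ _ _ _ _.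
have {ap}-> : ap = alpha_step Q rho v i j * alpha_path dk Q rho v (j :: t) by [].
have := IHt isT; set c := path_coef _; set a := alpha_path _ _ _ _ _.
set pr := \big[_/_]_(_ <- _ | _) _ => E.
have -> : top_count (i :: j :: t) = (is_top i + top_count (j :: t))%N by [].
rewrite exprD /is_top /block_gain; have [->|riM] := eqVneq (rho i) M.
  rewrite ltxx expr1 mul1r.
  by rewrite mulrACA [_ * c]E; field.
rewrite lt_neqAle riM rho_le /= expr0 mul1r.
have -> : M ^+ top_count (j :: t) * (M / (M - rho i) / M * alpha_step Q rho v i j * c) =
   (M - rho i)^-1 * alpha_step Q rho v i j * (M ^+ top_count (j :: t) * c).
  by field; rewrite M0 subr_eq0 eq_sym riM.
by rewrite E; ring.
Qed.

Lemma vasym_step p i j (g : nat -> 'cV[R]_d) c : vasym p g (c *: vemb j) ->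
  vasym (is_top i + p)
    (fun n => \sum_(m < n.+1) block_ker i (n - m) *m
       (if nat_of_ord m is m'.+1 then Q *m g m' else 0))
    ((block_gain i / M * alpha_step Q rho v i j * c) *: vemb i).
Proof.
move=> /vasym_shift /(vasym_ker i); apply: vasym_eq => //.
congr (_ *: _); rewrite /alpha_step coefE blk_emb.
rewrite -!scalemxAr /uemb /vemb !mulmxA !mxE; ring.
Qed.

Lemma surv_asym th : th != [::] ->
  vasym (top_count th) (path_survival th) (path_coef th *: head_vec th).
Proof.
elim: th => [//|i [|j t] IHt] _; last first.
  apply: vasym_eq (vasym_step i (IHt isT)) => // n.
  rewrite /path_survival pathsol_cons; apply: eq_bigr => m _; congr (_ *m _).
  by rewrite add0r.
have imp : vasym 0 (fun n => if n is 0 then block_proj i *m const_mx 1 else 0)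
                 (block_proj i *m const_mx 1).
  move=> x; have : 0 <= (block_proj i *m const_mx 1 : 'cV[R]_d) x 0.
    by apply: mulmx_ge0 => [a b|a b]; rewrite ?projE ?mxE ?ler0n ?ler01.
  by move/asym_impulse; apply: asym_eq => -[|n]; rewrite ?expr0 ?divr1 // mxE mul0r.
have := vasym_ker i imp; apply: vasym_eq => [n|].
  rewrite /path_survival pathsol_cons; apply: eq_bigr => m _; congr (_ *m _) => /=.
  by case: (nat_of_ord m) => [|m']; rewrite ?addr0 // /pathsol mulmx0 addr0.
rewrite /= /alpha_end coefE; congr (_ * _ *: _).
by rewrite /uemb mulmxA /block_proj mulmxA -(mulmxA (u i)) emb_trK mulmx1 -mulmxA emb_tr_const.
Qed.

(** Induction down to block [l], where the source is the survival solution, already a multiple of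
    [vemb l]. One more kernel of block [l] multiplies it by the gain, because u v = 1, and raises
    the order if [l] is a top block. *)
Lemma occ_asym l th : l \in th -> uniq th ->
  vasym (top_count th + is_top l) (path_occupation l th) ((block_gain l * path_coef th) *: head_vec th).
Proof.
elim: th => [//|i t IHt]; rewrite inE => li /andP[iNt t_uniq].
have [E|il] := eqVneq i l.
  subst i; have := vasym_ker l (surv_asym (isT : l :: t != [::])).
  rewrite addnC; apply: vasym_eq => [n|].
    rewrite /path_occupation pathsol_cons; apply: eq_bigr => m _; congr (_ *m _).
    rewrite /= eqxx; case: (nat_of_ord m) => [|m']; first by rewrite addr0.
    (* Uniqueness of the path keeps [l] out of the tail, so nothing flows in from there. *)
    by rewrite [pathsol _ _ _ _ _]occ_notin // mulmx0 addr0.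
  by rewrite -scalemxAr uemb_vemb !mxE mulr1.
rewrite eq_sym (negPf il) /= in li.
case: t li iNt t_uniq IHt => [//|j t] li iNt t_uniq /(_ li t_uniq) IHt.
have := vasym_step i IHt; rewrite addnA; apply: vasym_eq => [n|].
  rewrite {2}/path_occupation pathsol_cons; apply: eq_bigr => m _; congr (_ *m _).
  by rewrite /= (negPf il) add0r.
congr (_ *: _); set c := path_coef (i :: _).
have {c}-> : c = block_gain i / M * alpha_step Q rho v i j * path_coef (j :: t) by [].
by ring.
Qed.

(** * Dominant paths and the quotient of the two asymptotics *)

Hypothesis rho_maxE : rho_max rho = M.
Hypothesis sum_dk : (\sum_(i < k) dk i)%N = d.
Hypothesis Q_lower : forall i j : 'I_k, (i < j)%N -> blk dk Q i j = 0.
Variable pi : 'rV[R]_d.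
Hypothesis pi_ge0 : forall x, 0 <= pi 0 x.

Local Notation paths := (allPaths dk Q).
Local Notation Pmax := (inPmax dk Q rho).
Local Notation hmax := (hplus_max dk Q rho).

Lemma rho_path_le th : rho_path rho th <= M.
Proof.
rewrite /rho_path; elim: th => [|i t IHt]; first by rewrite big_nil ltW.
by rewrite big_cons ge_max rho_le.
Qed.

Lemma order_gt0 th : (0 < top_count th)%N = (rho_path rho th == M).
Proof.
elim: th => [|i t IHt]; first by rewrite /rho_path big_nil lt_eqF.
rewrite /rho_path big_cons /= -/(rho_path rho t) addn_gt0 -/(top_count t) IHt lt0b.
have eqM x : x <= M -> (x == M) = (M <= x) by rewrite eq_le => ->.
by rewrite !eqM ?le_max ?ge_max ?rho_le ?rho_path_le.
Qed.

Lemma hplus_order th : rho_path rho th = M -> hplus rho th = top_count th.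
Proof. by rewrite /hplus => ->. Qed.

Lemma order_le_hmax th : (0 < hmax)%N -> th \in paths -> (top_count th <= hmax)%N.
Proof.
move=> h0 th_path; have [E|/eqP/negPf] := pselect (rho_path rho th = M); last first.
  by rewrite -order_gt0 lt0n => /negbFE /eqP ->.
rewrite -hplus_order //; apply: leq_bigmax_seq => //.
by rewrite E rho_maxE.
Qed.

(** A path with [rho_path] below [M] has no top block, so a positive count of top blocks already
    enforces the second condition of [inPmax]. *)
Lemma inPmaxE th : (0 < hmax)%N -> Pmax th = (top_count th == hmax).
Proof.
move=> h0; rewrite /inPmax rho_maxE; have [E|/eqP/negPf] := pselect (rho_path rho th = M).
  by rewrite hplus_order // E eqxx andbT.
move=> E; rewrite E andbF; symmetry; apply/negbTE.
by move: E; rewrite -order_gt0 lt0n => /negbFE /eqP ->; rewrite eq_sym -lt0n.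
Qed.

Lemma dot_asym p W L : vasym p W L ->
  asym p (fun n => (pi *m W n) 0 0 / M ^+ n) ((pi *m L) 0 0).
Proof.
move=> WL.
have := @asym_sum R p _ (index_enum 'I_d) xpredT (fun x => pi 0 x) _ _
  (fun x _ => pi_ge0 x) (fun x _ => WL x).
rewrite mxE; apply: asym_eq => n.
by rewrite mxE mulr_suml; apply: eq_bigr => x _; rewrite mulrA.
Qed.

Lemma piv_head th : (pi *m head_vec th) 0 0 = first_piv dk v pi th.
Proof.
case: th => [|i t]; first by rewrite /= mulmx0 mxE.
by rewrite /= /piv blkrow_emb /vemb mulmxA.
Qed.

Definition path_limit th := path_coef th * first_piv dk v pi th.

(** Maximal paths have order exactly [h.+1], whose gauge is [binr h]; all other paths are of smaller
    order. *)
Lemma surv_total_lim h : hmax = h.+1 ->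
  tends (fun n => (pi *m Q ^+ n *m const_mx 1 : 'M_1) 0 0 / M ^+ n / binr R h n)
        (\sum_(th <- paths | Pmax th) path_limit th).
Proof.
move=> hE; have h0 : (0 < hmax)%N by rewrite hE.
rewrite big_mkcond big_seq /=.
have := @tends_sum R _ paths (fun th => th \in paths)
  (fun th n => (pi *m path_survival th n) 0 0 / M ^+ n / binr R h n)
  (fun th => if Pmax th then path_limit th else 0).
move=> H; apply: (tends_eq _ (H _)) => [n|th th_path].
  rewrite -big_seq -!mulr_suml; congr (_ / _ / _).
  by rewrite -mulmxA -(path_total_surv sum_dk Q_lower) /path_total mulmx_sumr summxE.
have th0 : th != [::] by apply: contraTneq th_path => ->; exact: nil_notin_paths.
have := dot_asym (surv_asym th0); rewrite -scalemxAr mxE piv_head.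
rewrite inPmaxE //; have := order_le_hmax h0 th_path; rewrite leq_eqVlt.
case: eqP => [->|_] /=; first by rewrite hE => _ [].
by rewrite hE ltnS => le_h aL; exact: asym_lt aL le_h.
Qed.

Lemma path_uniq th : th \in paths -> uniq th.
Proof.
rewrite mem_allPaths => /andP[_ /(sub_sorted (e' := fun a b : 'I_k => (b < a)%N))].
move=> /(_ (fun a b => ltac:(by case/andP))); apply: sorted_uniq => [a b c ba cb|a].
  exact: ltn_trans cb ba.
exact: ltnn.
Qed.

(** The gauge is one order higher than for survival. It is reached only by maximal paths through [l]
    with [l] a top block, whence the indicator in the limit. *)
Lemma occ_total_lim l h : hmax = h.+1 ->
  tends (fun n => (\sum_(m < n.+1)
      (pi *m Q ^+ m *m block_proj l *m Q ^+ (n - m) *m const_mx 1 : 'M_1) 0 0)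
      / M ^+ n / binr R h.+1 n)
    ((rho l == M)%:R * \sum_(th <- paths | Pmax th && (l \in th)) path_limit th).
Proof.
move=> hE; have h0 : (0 < hmax)%N by rewrite hE.
rewrite mulr_sumr big_mkcond big_seq /=.
have := @tends_sum R _ paths (fun th => th \in paths)
  (fun th n => (pi *m path_occupation l th n) 0 0 / M ^+ n / binr R h.+1 n)
  (fun th => if Pmax th && (l \in th) then (rho l == M)%:R * path_limit th else 0).
move=> H; apply: (tends_eq _ (H _)) => [n|th th_path].
  rewrite -big_seq -!mulr_suml; congr (_ / _ / _).
  have -> : \sum_(th <- paths) (pi *m path_occupation l th n) 0 0 =
      (pi *m path_total dk Q (occ_src dk Q l) n) 0 0 by rewrite /path_total mulmx_sumr summxE.
  rewrite (path_total_occ sum_dk Q_lower) mulmx_sumr summxE (reindex_inj rev_ord_inj) /=.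
  by apply: eq_bigr => m _; rewrite subSS subKn -1?ltnS // !mulmxA.
have [l_th|lN] := boolP (l \in th); rewrite ?andbT ?andbF; last first.
  by apply: (tends_eq _ (tends_cst 0)) => n; rewrite occ_notin // mulmx0 mxE !mul0r.
have := dot_asym (occ_asym l_th (path_uniq th_path)); rewrite -scalemxAr mxE piv_head.
rewrite inPmaxE //; have := order_le_hmax h0 th_path; rewrite /is_top /block_gain.
have [rl|rl] := eqVneq (rho l) M; rewrite ?mul1r ?mul0r ?addn1 ?addn0 ?if_same.
  rewrite leq_eqVlt; case: eqP => [->|_] /=; first by rewrite hE => _ [].
  by rewrite hE => le_h aL; exact: asym_lt aL le_h.
by rewrite hE => le_h aL; exact: asym_lt aL le_h.
Qed.

(** Each coefficient is a nonnegative row vector [u] applied to a nonnegative vector. Hence the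
    weights of different paths cannot cancel. *)
Lemma alpha_path_ge0 th : 0 <= alpha_path dk Q rho v th.
Proof.
have blk_ge0 i j a b : 0 <= blk dk Q i j a b by rewrite mxE.
elim: th => [|i [|j t] IHt]; first exact: ler01.
  rewrite /= /alpha_end coefE; apply: mulmx_ge0 => [a b|a b]; first by rewrite ord1.
  by rewrite mxE ler01.
rewrite [alpha_path _ _ _ _ _]/(alpha_step Q rho v i j * alpha_path dk Q rho v (j :: t)).
rewrite mulr_ge0 // /alpha_step coefE; apply: mulmx_ge0 => [a b|]; first by rewrite ord1.
by apply: mulmx_ge0 => // a b; rewrite ord1 ltW.
Qed.

Lemma first_piv_ge0 th : 0 <= first_piv dk v pi th.
Proof.
case: th => [|i t] //=; apply: mulmx_ge0 => a b; last by rewrite ord1 ltW.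
by rewrite mxE pi_ge0.
Qed.

(** The power of [M] is the same for all maximal paths, so it cancels in the quotient. *)
Lemma path_limit_weight th h : hmax = h.+1 -> th \in paths -> Pmax th ->
  path_limit th = M ^- h * weight dk Q rho v pi th.
Proof.
move=> hE th_path th_max; have M0 : M != 0 by rewrite gt_eqF.
have th0 : th != [::] by apply: contraTneq th_path => ->; exact: nil_notin_paths.
have /andP[_ /eqP] := th_max; rewrite /weight rho_maxE => ->.
have := path_coef_weight th0; move: th_max; rewrite inPmaxE hE // => /eqP -> E.
rewrite /path_limit; apply: (mulfI (expf_neq0 h.+1 M0)); rewrite mulrA E.
by rewrite exprS; field; rewrite expf_neq0.
Qed.

Lemma weight_ge0 th : Pmax th -> 0 <= weight dk Q rho v pi th.
Proof.
move=> /andP[_ /eqP th_max]; rewrite /weight !mulr_ge0 ?alpha_path_ge0 ?first_piv_ge0 //.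
by apply: prodr_ge0 => j _; rewrite invr_ge0 subr_ge0 rho_maxE.
Qed.

Lemma weight_neq0 th : Pmax th -> alpha_path dk Q rho v th != 0 ->
  first_piv dk v pi th != 0 -> weight dk Q rho v pi th != 0.
Proof.
move=> /andP[_ /eqP th_max] a0 p0; rewrite /weight !mulf_neq0 // th_max rho_maxE.
rewrite prodf_seq_neq0; apply/allP => j _; apply/implyP => jM.
by rewrite invr_eq0 subr_eq0 eq_sym lt_eqF.
Qed.

Lemma occupation_limit l : (exists2 th, (th \in paths) && Pmax th &
    (alpha_path dk Q rho v th != 0) && (first_piv dk v pi th != 0)) ->
  tends (fun n => (\sum_(m < n.+1)
      (pi *m Q ^+ m *m block_proj l *m Q ^+ (n - m) *m const_mx 1 : 'M_1) 0 0) / n.+1%:R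
      / (pi *m Q ^+ n *m const_mx 1 : 'M_1) 0 0)
    ((rho l == M)%:R * (\sum_(th <- paths | Pmax th && (l \in th)) weight dk Q rho v pi th)
     / (hmax%:R * \sum_(th <- paths | Pmax th) weight dk Q rho v pi th)).
Proof.
move=> [th0 /andP[th0_path th0_max] /andP[a0 p0]].
have M0 : M != 0 by rewrite gt_eqF.
have [h hE] : exists h, hmax = h.+1.
  have : (0 < top_count th0)%N.
    by rewrite order_gt0; have /andP[_] := th0_max; rewrite rho_maxE.
  have /andP[/eqP <- /eqP E] := th0_max; rewrite hplus_order ?E ?rho_maxE //.
  by case: (top_count th0) => // h _; exists h.
have wE (p : pred (seq 'I_k)) : \sum_(th <- paths | Pmax th && p th) path_limit th =
    M ^- h * \sum_(th <- paths | Pmax th && p th) weight dk Q rho v pi th.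
  rewrite mulr_sumr big_seq_cond [RHS]big_seq_cond; apply: eq_bigr => th /and3P[*].
  exact: path_limit_weight.
set B := \sum_(th <- _ | _ && _) _; set A := \sum_(th <- _ | _) _.
(* The path from (A2) has positive weight and every other maximal path a nonnegative one. *)
have A0 : A != 0.
  rewrite gt_eqF // /A (big_rem th0) //= th0_max ltr_wpDr //.
    by apply: sumr_ge0 => th /weight_ge0.
  by rewrite lt_neqAle eq_sym weight_neq0 ?weight_ge0.
have limB := occ_total_lim l hE; rewrite wE -/B in limB.
have limA := surv_total_lim hE.
have {}limA : tends (fun n => (pi *m Q ^+ n *m const_mx 1 : 'M_1) 0 0 / M ^+ n / binr R h n)
    (M ^- h * A).
  have andT (F : seq 'I_k -> R) :
      \sum_(th <- paths | Pmax th && predT th) F th = \sum_(th <- paths | Pmax th) F th.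
    by apply: eq_bigl => th; rewrite andbT.
  by have := wE predT; rewrite !andT => <-.
(* The ratio of the gauges is (n + h + 1) / (h + 1); dividing by n + 1 produces the factor 1 /
   [hmax]. *)
have limR : tends (fun n => binr R h.+1 n / (binr R h n * n.+1%:R)) h.+1%:R^-1.
  have := tendsM (tends_cst (h.+1%:R^-1 : R)) (tendsD (tends_cst (1 : R))
     (tendsM (tends_cst (h%:R : R)) (Tends (@cvg_harmonic R)))).
  rewrite mulr0 addr0 mulr1; apply: tends_eq => n; rewrite /= /harmonic /=.
  have := binrS R h n; rewrite addnS -addSn natrD => E.
  have h0 : h.+1%:R != 0 :> R by rewrite pnatr_eq0.
  have n0 : n.+1%:R != 0 :> R by rewrite pnatr_eq0.
  have b0 := binr_neq0 R h n.
  have -> : binr R h.+1 n = binr R h n * (n.+1%:R + h%:R) / h.+1%:R.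
    by rewrite -E mulfK.
  by field; rewrite !nat1r; apply/and3P.
have MA0 : M ^- h * A != 0 by rewrite mulf_neq0 // invr_eq0 expf_neq0.
have := tendsM (tendsM limB (tendsV MA0 limA)) limR.
have -> : (rho l == M)%:R * (M ^- h * B) / (M ^- h * A) / h.+1%:R =
    (rho l == M)%:R * B / (hmax%:R * A).
  by rewrite hE; field; rewrite A0 nat1r pnatr_eq0 expf_neq0.
apply: tends_eq => n; rewrite !invfM !invrK.
(* The inverse survival probability is treated as an atom, so the identity holds for every [n]
   without a separate proof that this probability is nonzero. *)
set N := \sum_(m < _) _; set D := (_ 0 0)^-1.
have ? := expf_neq0 n M0; have ? := binr_neq0 R h n; have ? := binr_neq0 R h.+1 n.
have n0 : n.+1%:R != 0 :> R by rewrite pnatr_eq0.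
by field; rewrite nat1r; apply/and4P.
Qed.

End Asymptotics.

(** * Occupation times as matrix products *)

Section Occupation.
Variables (R : realType) (d : nat) (P : 'M[R]_(1 + d)).
Local Notation Q := (drsubmx P : 'M[R]_d).
Local Notation state := 'I_(1 + d).
Implicit Types (psi : nat -> 'I_d -> R) (I : {set 'I_d}).

Lemma sum_ffunS (T : finType) (V : nmodType) n (G : {ffun 'I_n.+1 -> T} -> V) :
  \sum_x G x = \sum_s \sum_(x : {ffun 'I_n -> T})
     G [ffun m => if unlift ord0 m is Some m' then x m' else s].
Proof.
pose f (p : T * {ffun 'I_n -> T}) : {ffun 'I_n.+1 -> T} :=
  [ffun m => if unlift ord0 m is Some m' then p.2 m' else p.1].
pose g (x : {ffun 'I_n.+1 -> T}) := (x ord0, [ffun m => x (lift ord0 m)]).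
have fK : cancel f g.
  move=> [s x]; rewrite /g /f ffunE unlift_none; congr pair.
  by apply/ffunP => m; rewrite !ffunE liftK.
have gK : cancel g f.
  move=> x; apply/ffunP => m; rewrite ffunE /=.
  by case: unliftP => [j ->|->]; rewrite ?ffunE.
rewrite pair_big (reindex f) /=; last by exists g => x _; [exact: fK | exact: gK].
by apply: eq_bigr => -[s x].
Qed.

(** The value [0] at the absorbing state lets a product over all times encode survival. *)
Definition transient_weight psi m (s : state) : R :=
  if unlift ord0 s is Some y then psi m y else 0.

(** With D_m the diagonal matrix of [psi m], this is D_0 Q D_1 Q ... Q D_n applied to the all-ones
    vector. *)
Fixpoint transient_prod psi n : 'cV[R]_d :=
  \col_y (psi 0%N y *
    (if n is n'.+1 then (Q *m transient_prod (fun m => psi m.+1) n') y 0 else 1)).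

Lemma transient_prodS psi n y : transient_prod psi n.+1 y 0 =
  psi 0%N y * (Q *m transient_prod (fun m => psi m.+1) n) y 0.
Proof. by rewrite [LHS]mxE. Qed.

Lemma transient_prod0 psi y : transient_prod psi 0 y 0 = psi 0%N y.
Proof. by rewrite mxE mulr1. Qed.

(** A discrete Feynman-Kac formula, by decomposition at the first step. The starting weight [a] is
    arbitrary so that the induction can use a row of [P] in its place. *)
Lemma sum_paths n psi (a : state -> R) :
  \sum_(x : {ffun 'I_n.+1 -> state}) a (x ord0) *
    \prod_(m < n) P (x (widen_ord (leqnSn n) m)) (x (lift ord0 m)) *
    \prod_(m < n.+1) transient_weight psi m (x m) =
  \sum_y a (lift ord0 y) * transient_prod psi n y 0.
Proof.
have sum_state (g : state -> R) : g ord0 = 0 -> \sum_s g s = \sum_y g (lift ord0 y).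
  by move=> g0; rewrite big_ord_recl g0 add0r.
elim: n psi a => [|n IHn] psi a; rewrite sum_ffunS /=.
  transitivity (\sum_s a s * transient_weight psi 0 s).
    apply: eq_bigr => s _; rewrite (big_pred1 [ffun=> ord0]) => [|x] /=; last first.
      by apply/esym/eqP/ffunP => -[].
    by rewrite big_ord0 big_ord1 !ffunE unlift_none mulr1.
  rewrite sum_state; last by rewrite /transient_weight unlift_none mulr0.
  by apply: eq_bigr => y _; rewrite /transient_weight liftK mxE mulr1.
transitivity (\sum_s a s * transient_weight psi 0 s *
    \sum_y P s (lift ord0 y) * transient_prod (fun m => psi m.+1) n y 0).
  apply: eq_bigr => s _; rewrite -IHn mulr_sumr; apply: eq_bigr => x _.
  rewrite [in LHS]big_ord_recl [X in _ * X]big_ord_recl.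
  rewrite !ffunE /= unlift_none.
  have -> : widen_ord (leqnSn n.+1) ord0 = ord0 by exact: val_inj.
  rewrite unlift_none liftK.
  have -> : \prod_(i < n.+1) transient_weight psi (lift ord0 i)
     ([ffun m => if unlift ord0 m is Some m' then x m' else s] (lift ord0 i)) =
     \prod_(i < n.+1) transient_weight (fun m => psi m.+1) i (x i).
    by apply: eq_bigr => i _; rewrite ffunE liftK.
  under eq_bigr => i _.
    have -> : widen_ord (leqnSn n.+1) (lift ord0 i) = lift ord0 (widen_ord (leqnSn n) i).
      exact: val_inj.
    rewrite !ffunE !liftK.
    over.
  by rewrite /=; ring.
rewrite sum_state; last by rewrite /transient_weight unlift_none mulr0 mul0r.
apply: eq_bigr => y _; rewrite /transient_weight liftK mxE -mulrA; congr (_ * (_ * _)).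
by rewrite mxE; apply: eq_bigr => z _; rewrite !mxE !rshift1.
Qed.

Lemma transient_prod1 n : transient_prod (fun _ _ => 1) n = Q ^+ n *m const_mx 1.
Proof.
elim: n => [|n IHn]; apply/colP => y.
  by rewrite transient_prod0 expr0 mul1mx mxE.
by rewrite transient_prodS mul1r IHn exprS -mulmxE mulmxA.
Qed.

Definition visit I (m0 m : nat) (y : 'I_d) : R := if m == m0 then (y \in I)%:R else 1.

Lemma transient_prod_visit I m n : (m <= n)%N ->
  transient_prod (visit I m) n =
  Q ^+ m *m diag_mx (\row_y (y \in I)%:R) *m Q ^+ (n - m) *m const_mx 1.
Proof.
elim: m n => [|m IHm] n mn; apply/colP => y.
  rewrite expr0 mul1mx subn0 -mulmxA mul_diag_mx.
  rewrite [RHS]mxE [(\row_ _ _) _ _]mxE.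
  case: n mn => [|n] _; first by rewrite transient_prod0 /visit eqxx expr0 mul1mx mxE mulr1.
  by rewrite transient_prodS transient_prod1 exprS -mulmxE mulmxA.
case: n mn => [//|n] mn; rewrite transient_prodS mul1r.
have -> : (fun m' => visit I m.+1 m'.+1) = visit I m by [].
by rewrite IHm // subSS exprS -mulmxE !mulmxA.
Qed.

Variable pi : 'rV[R]_d.

Lemma sum_path_prob n psi :
  \sum_(x : {ffun 'I_n.+1 -> state}) path_prob P pi x *
    \prod_(m < n.+1) transient_weight psi m (x m) =
  (pi *m transient_prod psi n) 0 0.
Proof.
rewrite /path_prob sum_paths mxE; apply: eq_bigr => y _.
by rewrite /init_law liftK.
Qed.

Lemma survivesE n (x : {ffun 'I_n.+1 -> state}) :
  (survives x)%:R = \prod_(m < n.+1) transient_weight (fun _ _ => 1) m (x m).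
Proof.
have [/forallP x0|/forallPn [m]] := boolP (survives x).
  rewrite big1 // => m _; rewrite /transient_weight.
  by case: unliftP (x0 m) => [j //|->]; rewrite eqxx.
rewrite negbK => /eqP xm; rewrite (bigD1 m) //= xm /transient_weight unlift_none.
by rewrite mul0r.
Qed.

Lemma survives_visit n (x : {ffun 'I_n.+1 -> state}) I (m0 : 'I_n.+1) :
  (survives x)%:R * ([exists y in I, x m0 == lift ord0 y])%:R =
  \prod_(m < n.+1) transient_weight (visit I m0) m (x m).
Proof.
rewrite survivesE (bigD1 m0) //= [RHS](bigD1 m0) //= mulrAC; congr (_ * _); last first.
  apply: eq_bigr => m mN; rewrite /transient_weight /visit.
  by case: unlift => // y; rewrite (inj_eq val_inj) (negPf mN).
rewrite /transient_weight /visit eqxx; case: unliftP => [y ->|->]; last by rewrite mul0r.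
rewrite mul1r; congr (nat_of_bool _)%:R; apply/existsP/idP => [[z /andP[zI /eqP /lift_inj ->]]|yI] //.
by exists y; rewrite yI eqxx.
Qed.

(** The occupation count is a sum over times of indicators; for each time, survival together with
    the visit is a product of weights, to which the path formula applies. *)
Lemma cond_exp_occ I n :
  cond_exp P pi n (occ_frac I) =
  (\sum_(m < n.+1) (pi *m Q ^+ m *m diag_mx (\row_y (y \in I)%:R) *m
                      Q ^+ (n - m) *m const_mx 1 : 'M[R]_1) 0 0) / n.+1%:R
  / (pi *m Q ^+ n *m const_mx 1 : 'M[R]_1) 0 0.
Proof.
rewrite /cond_exp; congr (_ / _); last first.
  under eq_bigr do rewrite survivesE.
  by rewrite sum_path_prob transient_prod1 mulmxA.
transitivity (\sum_(m < n.+1) (pi *m transient_prod (visit I m) n) 0 0 / n.+1%:R); last first.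
  rewrite -mulr_suml; congr (_ / _); apply: eq_bigr => m _.
  by rewrite transient_prod_visit ?mulmxA // -ltnS.
under [RHS]eq_bigr do rewrite -sum_path_prob mulr_suml.
rewrite exchange_big /=; apply: eq_bigr => x _.
under [RHS]eq_bigr do rewrite -survives_visit.
rewrite -mulr_suml -mulr_sumr -mulr_sumr -!mulrA /occ_frac; congr (_ * (_ * (_ * (_ / _)))).
by rewrite -sum1dep_card natr_sum big_mkcond /=; apply: eq_bigr => m _; case: ifP.
Qed.

End Occupation.

(** * Limits of the conditional occupation fractions *)

Theorem theorem3p14 (R : realType) (d k : nat) (dk : 'I_k -> nat)
  (P : 'M[R]_(1 + d)) (pi : 'rV[R]_d)
  (rho : 'I_k -> R) (v : forall i : 'I_k, 'cV[R]_#|block d dk i|) :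
  (2 <= d)%N ->
  (* P = (1 0; R Q) stochastic, R <> 0, Q <> 0, spectrum of Q in the open unit disc *)
  stochastic P ->
  ulsubmx P = 1%:M -> ursubmx P = 0 ->
  dlsubmx P != 0 -> drsubmx P != 0 ->
  (forall z : R[i], cplx_eigenvalue (drsubmx P) z -> `|z| < 1) ->
  (* pi is a probability distribution on {1,...,d} *)
  (forall j, 0 <= pi 0 j) -> \sum_j pi 0 j = 1 ->
  (* Frobenius normal form of Q with block sizes d_1..d_k *)
  (forall i, (0 < dk i)%N) -> \sum_(i < k) dk i = d ->
  (forall i j : 'I_k, (i < j)%N -> blk dk (drsubmx P) i j = 0) ->
  (forall i, eventually_positive (blk dk (drsubmx P) i i)) ->
  (* rho_i the Perron-Frobenius eigenvalue of Q_ii, v_i a normed positive right eigenvector *)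
  (forall i, forall z : R[i], cplx_eigenvalue (blk dk (drsubmx P) i i) z ->
       `|z| <= ((rho i)%:C)%C) ->
  (forall i, blk dk (drsubmx P) i i *m v i = rho i *: v i) ->
  (forall i a, 0 < v i a 0) ->
  (forall i, \sum_a v i a 0 = 1) ->
  (* (A1) *)
  (forall i, rho i < rho_max rho -> is_scalar_mx (blk dk (drsubmx P) i i)) ->
  (* (A2) *)
  (exists2 th : seq 'I_k,
      (th \in allPaths dk (drsubmx P)) && inPmax dk (drsubmx P) rho th &
      (alpha_path dk (drsubmx P) rho v th != 0) && (first_piv dk v pi th != 0)) ->
  forall l : 'I_k,
  let Pl := [seq th <- allPaths dk (drsubmx P) |
               inPmax dk (drsubmx P) rho th && (l \in th)] in
  let Pm := [seq th <- allPaths dk (drsubmx P) | inPmax dk (drsubmx P) rho th] in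
  let E := fun n : nat => cond_exp P pi n (occ_frac (block d dk l)) in
  ((rho l < rho_max rho \/ Pl = [::]) -> E @ \oo --> (0 : R)) /\
  ((rho l = rho_max rho /\ Pl != [::]) ->
     E @ \oo -->
       (\sum_(th <- Pl) weight dk (drsubmx P) rho v pi th) /
       ((hplus_max dk (drsubmx P) rho)%:R *
          \sum_(th <- Pm) weight dk (drsubmx P) rho v pi th)).
Proof.
move=> _ Pst _ _ _ _ _ pi_ge0 _ _ sum_dk Q_lower blk_pos _ blk_v v_gt0 v_sum1.
set Q := drsubmx P in Q_lower blk_pos blk_v *; move=> blk_scalar A2 l Pl Pm E.
have Q_ge0 x y : 0 <= Q x y by rewrite !mxE; case: Pst.
have blk_ge0 i a b : 0 <= blk dk Q i i a b by rewrite mxE.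
(* Entries of [v i] that sum to [1] cannot be indexed by an empty block. *)
have block_gt0 i : (0 < #|block d dk i|)%N.
  rewrite lt0n; apply/eqP => b0; have := v_sum1 i; rewrite big1 => [/eqP|a _].
    by rewrite eq_sym oner_eq0.
  by have := ltn_ord a; rewrite {2}b0.
have PF i := perron_frobenius (block_gt0 i) (blk_ge0 i) (blk_pos i) (blk_v i) (v_gt0 i).
have rho_gt0 i : 0 < rho i by case: (PF i).
pose u i := sval (cid (PF i).2).
have uP i := svalP (cid (PF i).2); rewrite -/(u _) in uP.
have u_ge0 i a : 0 <= u i 0 a by case: (uP i).
have uB i : u i *m blk dk Q i i = rho i *: u i by case: (uP i).
have uv1 i : u i *m v i = 1%:M by case: (uP i).
have blk_lim i a b : tends (fun m => (blk dk Q i i ^+ m) a b / rho i ^+ m) ((v i *m u i) a b).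
  by case: (uP i).
have coefE i x : coef (blk dk Q i i) (rho i) (v i) x = (u i *m x) 0 0.
  apply: coef_left_eigen => // y By; rewrite mulmxA.
  exact: eigenvector_limit (lt0r_neq0 (rho_gt0 i)) (blk_lim i) By.
have rho_le i : rho i <= rho_max rho by apply: le_bigmax.
have M_gt0 : 0 < rho_max rho by exact: lt_le_trans (rho_gt0 l) (rho_le l).
have [lim] := occupation_limit Q_ge0 rho_gt0 rho_le M_gt0 v_gt0 u_ge0 uv1 blk_v
  blk_lim blk_scalar coefE (erefl _) sum_dk Q_lower pi_ge0 l A2.
have projE : diag_mx (\row_y (y \in block d dk l)%:R) = block_proj R d dk l.
  by apply/matrixP => x y; rewrite projE !mxE; case: eqP => [->|]; case: (_ \in _).
have {}lim : E @ \oo --> ((rho l == rho_max rho)%:R * (\sum_(th <- Pl) weight dk Q rho v pi th)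
     / ((hplus_max dk Q rho)%:R * \sum_(th <- Pm) weight dk Q rho v pi th)).
  rewrite /Pl /Pm !big_filter; have -> : E = (fun n => cond_exp P pi n (occ_frac (block d dk l))) by [].
  by under eq_fun do rewrite cond_exp_occ projE; exact: lim.
(* One limit serves both claims: the indicator is [1] in (ii), while in (i) either the indicator or
   the sum over [Pl] vanishes. *)
split=> [H|[rl _]]; last by rewrite rl eqxx mul1r in lim.
suff E0 : (rho l == rho_max rho)%:R * (\sum_(th <- Pl) weight dk Q rho v pi th) = 0.
  by rewrite E0 mul0r in lim.
by case: H => [rl|->]; [rewrite lt_eqF // mul0r | rewrite big_nil mulr0].
Qed.
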